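(* Let $m\in\mathbb{N}$ (with $m=0$ allowed), let $\theta\in(-\pi,\pi)$, $z=e^{i\theta}$ and $a=\cos\theta$. Then $$N_{0,4}(a;m)=\frac{B\left(\tfrac12,2m+\tfrac32\right)}{2B(m+1,m+1)}\,\sqrt{z}\,I_m(z).$$
   Context: For $m\in\mathbb{N}$ and $a>-1$, $N_{0,4}(a;m)=\int_{0}^{\infty}\frac{dx}{(x^{4}+2ax^{2}+1)^{m+1}}$. $B(p,q)=\int_0^1x^{p-1}(1-x)^{q-1}\,dx$ is the Euler beta function. The function $I_m$ is defined by $$I_m(z)=\int_{0}^{1}\frac{x^{m}(1-x)^{m}}{\sqrt{1+(z^{2}-1)x}}\,dx.$$
   Formalization: For Re z ≤ 0 (|θ| ≥ π/2), I_m(z) means the analytic continuation to C minus (−∞,0] of the integral, which is taken literally with principal root only for Re z > 0; with the literal integral the identity fails for π/2 < |θ| < π. *)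

(* Defs.v *)
From Stdlib Require Import Reals Lra ClassicalEpsilon.
From Coquelicot Require Import Coquelicot.
Open Scope R_scope.

Definition N04 (a : R) (m : nat) : R :=
  RInt_gen (fun x : R => / (x ^ 4 + 2 * a * x ^ 2 + 1) ^ (m + 1))
    (at_point 0) (Rbar_locally p_infty).

(* Improper at both ends, so that p, q < 1 (with p, q > 0) are covered. *)
Definition Beta (p q : R) : R :=
  RInt_gen (fun x : R => Rpower x (p - 1) * Rpower (1 - x) (q - 1))
    (at_right 0) (at_left 1).

(* e^{i theta} *)
Definition cis (theta : R) : C := (cos theta, sin theta).

(* Principal square root: Arg (Csqrt z) in ]-PI/2, PI/2]. See [Csqrt_sq],
   [Csqrt_principal] and [Csqrt_cis] below. *)
Definition Csqrt (z : C) : C :=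
  (sqrt ((Cmod z + Re z) / 2),
   (if Rle_dec 0 (Im z) then 1 else -1) * sqrt ((Cmod z - Re z) / 2)).

(* The integral of the definition of I_m, with the principal square root.
   For Re z > 0 the segment from 1 to z^2 described by 1 + (z^2 - 1) x does not
   meet the cut ]-oo, 0], so that the integrand is continuous on [0, 1]. *)
Definition I_integral (m : nat) (z : C) : C :=
  RInt (V := C_R_CompleteNormedModule)
    (fun x : R =>
       (RtoC (x ^ m * (1 - x) ^ m) / Csqrt (1 + (z ^ 2 - 1) * RtoC x))%C)
    0 1.

Definition analytic_at (f : C -> C) (z0 : C) : Prop :=
  exists c : nat -> C,
    locally z0 (fun z : C =>
      is_pseries (K := C_AbsRing) (V := C_NormedModule) c (z - z0)%C (f z)).

(* C \ ]-oo, 0] *)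
Definition slit_plane (z : C) : Prop := ~ (Im z = 0 /\ Re z <= 0).

Definition is_continuation_of_I (m : nat) (f : C -> C) : Prop :=
  (forall z : C, slit_plane z -> analytic_at f z) /\
  (forall z : C, 0 < Re z -> f z = I_integral m z).

(* I_m as an analytic function on C \ ]-oo, 0]: the integral for Re z > 0,
   extended analytically (the extension is unique, the slit plane being
   connected). The extension cannot be dispensed with: [I_integral m] is even in
   z, so for PI/2 < theta < PI replacing theta by theta - PI multiplies
   sqrt z * I_integral m z by -i, whereas N04 (cos theta) m > 0 for all theta
   in ]-PI, PI[. *)
Definition I_ (m : nat) : C -> C :=
  epsilon (inhabits (fun _ : C => RtoC 0)) (is_continuation_of_I m).

Lemma Re_le_Cmod (z : C) : - Cmod z <= Re z <= Cmod z.
Proof.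
apply Rabs_le_between, re_le_Cmod.
Qed.

Lemma Csqrt_sq (z : C) : (Csqrt z * Csqrt z)%C = z.
Proof.
pose proof (Re_le_Cmod z) as Hz.
assert (Hp : 0 <= (Cmod z + Re z) / 2) by lra.
assert (Hm : 0 <= (Cmod z - Re z) / 2) by lra.
assert (E : sqrt ((Cmod z + Re z) / 2) * sqrt ((Cmod z - Re z) / 2)
            = Rabs (Im z) / 2).
{ rewrite <- sqrt_mult by assumption.
  replace ((Cmod z + Re z) / 2 * ((Cmod z - Re z) / 2))
    with (Rsqr (Im z / 2)).
  - rewrite sqrt_Rsqr_abs. unfold Rdiv. rewrite Rabs_mult.
    rewrite (Rabs_pos_eq (/ 2)) by lra. reflexivity.
  - pose proof (Cmod2_alt z) as H. unfold Rsqr. simpl in H. nra. }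
pose proof (sqrt_sqrt _ Hp) as Sp. pose proof (sqrt_sqrt _ Hm) as Sm.
unfold Csqrt, Cmult. destruct z as [x y]; simpl in *.
set (u := sqrt ((Cmod (x, y) + x) / 2)) in *.
set (v := sqrt ((Cmod (x, y) - x) / 2)) in *.
destruct (Rle_dec 0 y) as [Hy|Hy].
- rewrite (Rabs_pos_eq y Hy) in E. apply injective_projections; simpl; nra.
- rewrite (Rabs_left y) in E by lra.
  apply injective_projections; simpl; nra.
Qed.

Lemma Csqrt_principal (z : C) :
  0 < Re (Csqrt z) \/ (Re (Csqrt z) = 0 /\ 0 <= Im (Csqrt z)).
Proof.
pose proof (Re_le_Cmod z) as Hz.
destruct (Rlt_dec 0 (Cmod z + Re z)) as [H|H].
- left. simpl. apply sqrt_lt_R0. lra.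
- right. simpl. split.
  + replace ((Cmod z + Re z) / 2) with 0 by lra. apply sqrt_0.
  + assert (Hi : Im z = 0).
    { pose proof (Cmod2_alt z) as H2. simpl in H2.
      assert (Im z * Im z = 0) by nra. nra. }
    rewrite Hi. destruct (Rle_dec 0 0); [|lra].
    rewrite Rmult_1_l. apply sqrt_pos.
Qed.

Lemma Csqrt_cis (theta : R) :
  - PI < theta < PI -> Csqrt (cis theta) = cis (theta / 2).
Proof.
intros Ht.
assert (Hm : Cmod (cis theta) = 1).
{ transitivity (sqrt 1); [unfold Cmod, cis; simpl; f_equal | apply sqrt_1].
  pose proof (sin2_cos2 theta) as H. unfold Rsqr in H. lra. }
assert (Hc : cos theta = 2 * cos (theta / 2) * cos (theta / 2) - 1).
{ rewrite <- cos_2a_cos. f_equal. field. }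
assert (Hs : sin theta = 2 * sin (theta / 2) * cos (theta / 2)).
{ rewrite <- sin_2a. f_equal. field. }
assert (Hpos : 0 < cos (theta / 2)) by (pose proof PI_RGT_0; apply cos_gt_0; lra).
pose proof (sin2_cos2 (theta / 2)) as H2.
unfold Csqrt. rewrite Hm. unfold cis; simpl.
replace ((1 + cos theta) / 2) with (Rsqr (cos (theta / 2)))
  by (unfold Rsqr; lra).
replace ((1 - cos theta) / 2) with (Rsqr (sin (theta / 2)))
  by (unfold Rsqr in *; lra).
rewrite !sqrt_Rsqr_abs, (Rabs_pos_eq (cos _)) by lra.
f_equal. destruct (Rle_dec 0 (sin theta)) as [H|H].
- assert (0 <= sin (theta / 2)) by (apply Rnot_lt_le; intro; nra).
  rewrite Rabs_pos_eq by assumption. ring.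
- assert (sin (theta / 2) < 0) by (apply Rnot_le_lt; intro; nra).
  rewrite Rabs_left by assumption. ring.
Qed.

(* Main.v *)
Require Import Defs.
From Stdlib Require Import Reals Lra Lia ClassicalEpsilon.
From Coquelicot Require Import Coquelicot.
Open Scope R_scope.

(* For Re z > 0 the substitution u = sqrt (1 + (z^2 - 1) x), followed by a
   change of path to the segment u = 1 + (z - 1) t, gives
     I_m(z) = 2 Q_m(z) / (z + 1)^(2m+1),
     Q_m(z) = int_0^1 [t (1 - t) (2 + (z - 1) t) (z + 1 + (z - 1) t)]^m dt,
   where Q_m is a polynomial. The right-hand side is analytic off z = -1, so by
   the identity theorem it is the continuation of I_m to the slit plane.

   Put D = x^4 + 2 a x^2 + 1, N_m = int_0^oo D^(-m-1) and
   N'_m = int_0^oo x^2 D^(-m-1). As (u^2 - 1)(z^2 - u^2) = - z^2 D(x) for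
   u^2 = - z x^2, integrating exact derivatives yields first-order recurrences
   for (N_m, N'_m) and for (Q_m, int u^2 [...]^m) that come from a single one,
   with exponents -m-1 and m respectively. They are matched by induction on m
   through
     N_m = n_m Q_m,
     (4m+1) N'_m = - n_m ((4m+2) a Q_m - (4m+3) (int u^2 [...]^m) / z),
   where n_m is a constant times sqrt z / (z + 1)^(2m+1). The recurrences
   degenerate at a = 1, where N_m is itself a Beta integral. *)

(** * Complex power series *)

(** Under u^2 = - z x^2 the two families live on the same curve with exponents -m-1 and m, so this
    substitution alone does not carry one to the other. What they share is a recurrence in the
    exponent, run in opposite directions, and equality has to be checked on its solutions. A single
    integral does not close under the recurrence, hence the companion with one more square. The
    odd-looking second relation is forced: N_(m+1) is linear in N_m and N'_m, Q_(m+1) is linear in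
    Q_m and its companion, and N = n Q at both m and m+1 leaves, for a <> 0, one possible value of
    N'_m. The degeneration at a = 1 is the denominator 1 - a^2 = - (z^2 - 1)^2 / (4 z^2). The change
    of path uses no contour theorem: both paths run from 1 to z and the form is polynomial in u, so
    each integral is the increment of one and the same polynomial primitive. Analyticity is likewise
    kept at the level of power series: Q_m is handled as a polynomial, and division by z + 1 as a
    product with a geometric series. *)

Notation is_Cpseries := (is_pseries (K := C_AbsRing) (V := C_NormedModule)).

Definition psum (c : nat -> C) (x : C) : nat -> C :=
  @sum_n C_AbelianMonoid (fun k => (x ^ k * c k)%C).

Lemma psum_0 c x : psum c x 0 = c 0%nat.
Proof. unfold psum. rewrite sum_O. simpl. ring. Qed.

Lemma psum_S c x n : psum c x (S n) = (psum c x n + x ^ S n * c (S n))%C.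
Proof. unfold psum. now rewrite sum_Sn. Qed.

Lemma is_pseries_C_iff (c : nat -> C) (x l : C) :
  is_pseries (K := C_AbsRing) (V := C_NormedModule) c x l <->
  forall eps : R, 0 < eps ->
    exists N : nat, forall n : nat, (N <= n)%nat -> Cmod (psum c x n - l) < eps.
Proof.
assert (E : forall n, sum_n (G := C_AbelianMonoid)
  (fun k => scal (K := C_AbsRing) (V := C_NormedModule) (pow_n x k) (c k)) n = psum c x n).
{ intros n. apply sum_n_ext. intros k.
  assert (H : pow_n (K := C_Ring) x k = (x ^ k)%C).
  { induction k as [|k IH]; [reflexivity|]. simpl. now rewrite IH. }
  change (pow_n (K := C_Ring) x k * c k = x ^ k * c k)%C. now rewrite H. }
unfold is_pseries, is_series. split.
- intros H eps Heps.
  specialize (proj1 (filterlim_locally_ball_norm (K := C_AbsRing) (U := C_NormedModule) _ _) H (mkposreal eps Heps)).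
  intros [N HN]. exists N. intros n Hn. specialize (HN n Hn).
  unfold ball_norm in HN. simpl in HN. rewrite <- E. exact HN.
- intros H. apply (filterlim_locally_ball_norm (K := C_AbsRing) (U := C_NormedModule)).
  intros [eps Heps]. destruct (H eps Heps) as [N HN]. exists N. intros n Hn.
  specialize (HN n Hn). rewrite <- E in HN. exact HN.
Qed.

Lemma Cmod_minus_sym (x y : C) : Cmod (x - y) = Cmod (y - x).
Proof. rewrite <- Cmod_opp. f_equal. ring. Qed.

(** A term is the difference of two consecutive partial sums. Beyond rank N both lie within 1 of the
    sum, so the term is at most 2; finitely many terms remain. *)
Lemma is_Cpseries_coef_bound (c : nat -> C) (x l : C) :
  is_Cpseries c x l -> exists M, forall n, Cmod (c n) * Cmod x ^ n <= M.
Proof.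
intros H. destruct (proj1 (is_pseries_C_iff c x l) H 1 Rlt_0_1) as [N HN].
assert (HB : forall K, exists M, forall n, (n <= K)%nat -> Cmod (c n) * Cmod x ^ n <= M).
{ induction K as [|K [M HM]].
  - exists (Cmod (c 0%nat) * Cmod x ^ 0). intros n Hn. replace n with 0%nat by lia. lra.
  - exists (Rmax M (Cmod (c (S K)) * Cmod x ^ S K)). intros n Hn.
    destruct (Nat.eq_dec n (S K)) as [->|Hn']; [apply Rmax_r|].
    eapply Rle_trans; [apply HM; lia | apply Rmax_l]. }
destruct (HB N) as [M HM]. exists (Rmax M 2). intros n.
destruct (Nat.le_gt_cases n N) as [Hn|Hn].
- eapply Rle_trans; [now apply HM | apply Rmax_l].
- eapply Rle_trans; [|apply Rmax_r].
  destruct n as [|n]; [lia|].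
  assert (E : (x ^ S n * c (S n) = (psum c x (S n) - l) - (psum c x n - l))%C)
    by (rewrite psum_S; ring).
  rewrite <- Cmod_pow, Rmult_comm, <- Cmod_mult, E.
  unfold Cminus at 1. eapply Rle_trans; [apply Cmod_triangle|]. rewrite Cmod_opp.
  pose proof (HN (S n) ltac:(lia)). pose proof (HN n ltac:(lia)). lra.
Qed.

(** With q = rho |x| <= 1/2, the terms after the constant one are dominated by M q (1 + 1/2 + 1/4 +
    ...) = 2 M q. This is continuity at the centre, in quantitative form. *)
Lemma is_Cpseries_near_const (c : nat -> C) (x l : C) (M rho : R) :
  (forall n, Cmod (c n) <= M * rho ^ n) -> 0 <= rho -> rho * Cmod x <= 1 / 2 ->
  is_Cpseries c x l -> Cmod (l - c 0%nat) <= 2 * M * rho * Cmod x.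
Proof.
intros Hc Hrho Hx H.
assert (HM : 0 <= M) by (pose proof (Hc 0%nat); pose proof (Cmod_ge_0 (c 0%nat)); simpl in *; lra).
pose proof (Cmod_ge_0 x) as Hx0.
set (q := rho * Cmod x) in *.
assert (Hq : 0 <= q) by (apply Rmult_le_pos; assumption).
(* The factor 1 - (1/2)^n makes the induction close; the bare bound 2 M q would not. *)
assert (HS : forall n, Cmod (psum c x n - c 0%nat) <= 2 * M * q * (1 - (1 / 2) ^ n)).
{ induction n as [|n IH].
  - rewrite psum_0. replace (c 0%nat - c 0%nat)%C with (RtoC 0) by ring.
    rewrite Cmod_0. simpl. lra.
  - rewrite psum_S.
    replace (psum c x n + x ^ S n * c (S n) - c 0%nat)%C
      with ((psum c x n - c 0%nat) + x ^ S n * c (S n))%C by ring.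
    eapply Rle_trans; [apply Cmod_triangle|].
    assert (Ht : Cmod (x ^ S n * c (S n)) <= M * q * (1 / 2) ^ n).
    { rewrite Cmod_mult, Cmod_pow.
      apply Rle_trans with (Cmod x ^ S n * (M * rho ^ S n)).
      - apply Rmult_le_compat_l; [now apply pow_le | apply Hc].
      - replace (Cmod x ^ S n * (M * rho ^ S n)) with (M * q * q ^ n)
          by (unfold q; rewrite Rpow_mult_distr; simpl; ring).
        apply Rmult_le_compat_l; [now apply Rmult_le_pos|]. apply pow_incr. lra. }
    simpl pow. lra. }
apply Rnot_lt_le. intros Hlt.
destruct (proj1 (is_pseries_C_iff c x l) H (Cmod (l - c 0%nat) - 2 * M * q)) as [N HN].
{ unfold q. lra. }
specialize (HN N (le_n N)). specialize (HS N).
assert (Hp : 0 <= (1 / 2) ^ N) by (apply pow_le; lra).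
assert (0 <= M * q * (1 / 2) ^ N) by (repeat apply Rmult_le_pos; lra).
assert (Cmod (l - c 0%nat) <= Cmod (psum c x N - c 0%nat) + Cmod (psum c x N - l)).
{ rewrite (Cmod_minus_sym (psum c x N) l).
  replace (l - c 0%nat)%C with ((psum c x N - c 0%nat) + (l - psum c x N))%C by ring.
  apply Cmod_triangle. }
nra.
Qed.

(** Zeros accumulating at 0 kill the constant coefficient by continuity; then h y / y has the
    shifted coefficients and the same zeros. Only y <> 0 is considered, so that the hypotheses pass
    from h to this quotient. *)
Lemma is_Cpseries_coefs_zero (c : nat -> C) (h : C -> C) (delta : R) :
  0 < delta ->
  (forall y : C, y <> 0 -> Cmod y < delta -> is_Cpseries c y (h y)) ->
  (forall eps, 0 < eps -> exists y : C, y <> 0 /\ Cmod y < eps /\ h y = 0) ->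
  forall n, c n = 0.
Proof.
intros Hd H Hz n. revert c h H Hz.
assert (H0 : forall (c : nat -> C) (h : C -> C),
  (forall y : C, y <> 0 -> Cmod y < delta -> is_Cpseries c y (h y)) ->
  (forall eps, 0 < eps -> exists y : C, y <> 0 /\ Cmod y < eps /\ h y = 0) ->
  c 0%nat = 0).
{ intros c h H Hz.
  assert (Hx0 : RtoC (delta / 2) <> 0) by (intros E; apply RtoC_inj in E; lra).
  assert (Hm : Cmod (RtoC (delta / 2)) = delta / 2) by (rewrite Cmod_R; apply Rabs_pos_eq; lra).
  destruct (is_Cpseries_coef_bound c _ _ (H _ Hx0 ltac:(lra))) as [M HM].
  rewrite Hm in HM.
  assert (Hdp : forall n, 0 < (delta / 2) ^ n) by (intros; apply pow_lt; lra).
  set (rho := / (delta / 2)).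
  assert (Hr : 0 < rho) by (apply Rinv_0_lt_compat; lra).
  assert (Hc : forall n, Cmod (c n) <= M * rho ^ n).
  { intros k. unfold rho. rewrite pow_inv. apply Rmult_le_reg_r with ((delta / 2) ^ k); [apply Hdp|].
    rewrite Rmult_assoc, Rinv_l, Rmult_1_r by (apply Rgt_not_eq, Hdp). apply HM. }
  assert (HM0 : 0 <= M) by (pose proof (HM 0%nat); pose proof (Cmod_ge_0 (c 0%nat)); simpl in *; lra).
  apply Cmod_eq_0, Rle_antisym; [|apply Cmod_ge_0].
  apply Rnot_lt_le. intros Hlt.
  (* As rho = 2 / delta, the bound delta / 4 gives rho |y| <= 1/2. The other bound contradicts |c 0|
     <= 2 M rho |y|; its + 1 keeps the denominator positive when M = 0. *)
  destruct (Hz (Rmin (delta / 4) (Cmod (c 0%nat) / (2 * M * rho + 1)))) as (y & Hy & Hye & Hhy).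
  { apply Rmin_glb_lt; [lra|]. apply Rdiv_lt_0_compat; [assumption|]. nra. }
  assert (Hy1 := Rlt_le_trans _ _ _ Hye (Rmin_l _ _)).
  assert (Hy2 := Rlt_le_trans _ _ _ Hye (Rmin_r _ _)).
  assert (Hb : rho * Cmod y <= 1 / 2).
  { apply Rmult_le_reg_l with (delta / 2); [lra|]. unfold rho.
    rewrite <- Rmult_assoc, Rinv_r, Rmult_1_l by lra. lra. }
  pose proof (is_Cpseries_near_const c y _ M rho Hc (Rlt_le _ _ Hr) Hb (H y Hy ltac:(lra))) as Hn.
  rewrite Hhy in Hn. replace (0 - c 0%nat)%C with (- c 0%nat)%C in Hn by ring.
  rewrite Cmod_opp in Hn.
  assert (HMr : 0 <= M * rho) by nra.
  apply (Rmult_lt_compat_r (2 * M * rho + 1)) in Hy2; [|nra].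
  replace (Cmod (c 0%nat) / (2 * M * rho + 1) * (2 * M * rho + 1)) with (Cmod (c 0%nat)) in Hy2
    by (field; nra).
  pose proof (Cmod_ge_0 y). nra. }
induction n as [|n IH]; intros c h H Hz; [now apply (H0 c h)|].
assert (Hc0 := H0 c h H Hz).
apply (IH (fun n => c (S n)) (fun y => h y / y)%C).
- intros y Hy Hyd.
  pose proof (is_pseries_decr_1 (K := C_AbsRing) (V := C_NormedModule) c y (/ y)%C (h y)
    (Cinv_l y Hy) (H y Hy Hyd)) as Hp.
  replace (h y / y)%C with (/ y * (h y + - c 0%nat))%C; [exact Hp|].
  rewrite Hc0. field. assumption.
- intros eps Heps. destruct (Hz eps Heps) as (y & Hy & Hye & Hhy).
  exists y. repeat split; try assumption. rewrite Hhy. field. assumption.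
Qed.

Lemma is_Cpseries_zero (c : nat -> C) (x l : C) : (forall n, c n = 0) -> is_Cpseries c x l -> l = 0.
Proof.
intros Hc H.
pose proof (is_Cpseries_near_const c x l 0 0) as Hn.
replace l with (l - c 0%nat)%C by (rewrite Hc; ring).
apply Cmod_eq_0, Rle_antisym; [|apply Cmod_ge_0].
replace 0 with (2 * 0 * 0 * Cmod x) by ring. apply Hn; try lra; try assumption.
intros n. rewrite Hc, Cmod_0. lra.
Qed.

(** * Identity theorem and analytic quotients *)

Lemma locally_C_ball (z0 : C) (P : C -> Prop) :
  locally z0 P <-> exists delta, 0 < delta /\ forall z, Cmod (z - z0) < delta -> P z.
Proof.
split.
- intros H. destruct (locally_norm_le_locally (K := C_AbsRing) (V := C_NormedModule) z0 P H) as [d Hd].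
  exists d. split; [apply cond_pos|]. intros z Hz. apply Hd. exact Hz.
- intros (d & Hd & H). apply (locally_le_locally_norm (K := C_AbsRing) (V := C_NormedModule) z0 P).
  exists (mkposreal d Hd). intros z Hz. apply H. exact Hz.
Qed.

Lemma analytic_eq_near (f g : C -> C) (z0 : C) :
  analytic_at f z0 -> analytic_at g z0 ->
  (forall eps, 0 < eps -> exists z : C, z <> z0 /\ Cmod (z - z0) < eps /\ f z = g z) ->
  exists delta, 0 < delta /\ forall z : C, Cmod (z - z0) < delta -> f z = g z.
Proof.
intros [c Hc] [d Hd] Hz.
apply locally_C_ball in Hc. destruct Hc as (d1 & Hd1 & Hc).
apply locally_C_ball in Hd. destruct Hd as (d2 & Hd2 & Hd).
assert (Hm : 0 < Rmin d1 d2) by now apply Rmin_glb_lt.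
exists (Rmin d1 d2). split; [assumption|].
set (e := PS_minus (K := C_AbsRing) (V := C_NormedModule) c d).
assert (He : forall y : C, Cmod y < Rmin d1 d2 -> is_Cpseries e y (f (z0 + y) - g (z0 + y))%C).
{ intros y Hy. pose proof (Rmin_l d1 d2). pose proof (Rmin_r d1 d2).
  assert (E : (z0 + y - z0)%C = y) by ring.
  pose proof (Hc (z0 + y)%C ltac:(rewrite E; lra)) as H1.
  pose proof (Hd (z0 + y)%C ltac:(rewrite E; lra)) as H2.
  rewrite E in H1, H2.
  exact (is_pseries_minus (K := C_AbsRing) (V := C_NormedModule) _ _ _ _ _ H1 H2). }
assert (H0 : forall n, e n = RtoC 0).
{ apply (is_Cpseries_coefs_zero e (fun y => f (z0 + y) - g (z0 + y))%C (Rmin d1 d2) Hm).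
  - intros y _. apply He.
  - intros eps Heps. destruct (Hz eps Heps) as (z & Hzz & Hze & Hfg).
    exists (z - z0)%C. split; [now apply Cminus_eq_contra|]. split; [assumption|].
    replace (z0 + (z - z0))%C with z by ring. rewrite Hfg. ring. }
intros z Hzd. apply Ceq_minus.
replace z with (z0 + (z - z0))%C by ring.
exact (is_Cpseries_zero e _ _ H0 (He _ Hzd)).
Qed.

(** Let T be the supremum of the parameters up to which f and g agree. Points of agreement
    accumulate at T from below, so the functions agree on a ball around that point; this would push
    the supremum further unless T = 1. Segments suffice later because the slit plane is star-shaped
    about 1. *)
Lemma analytic_eq_segment (f g : C -> C) (a b : C) (eps : R) :
  0 < eps ->
  (forall t : R, 0 <= t <= 1 -> analytic_at f (a + t * (b - a))%C) ->
  (forall t : R, 0 <= t <= 1 -> analytic_at g (a + t * (b - a))%C) ->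
  (forall t : R, 0 <= t < eps -> f (a + t * (b - a))%C = g (a + t * (b - a))%C) ->
  f b = g b.
Proof.
intros Heps Hf Hg Hfg.
assert (Eb : (a + 1%R * (b - a))%C = b) by ring.
destruct (Ceq_dec a b) as [Hab|Hab].
{ rewrite <- Eb, <- Hab. specialize (Hfg 0 ltac:(lra)).
  replace (a + 0%R * (b - a))%C with a in Hfg by ring.
  replace (a + 1%R * (a - a))%C with a by ring. assumption. }
assert (HL : 0 < Cmod (b - a)) by (apply Cmod_gt_0, Cminus_eq_contra; congruence).
set (L := Cmod (b - a)) in *.
assert (Hdist : forall s t : R, Cmod ((a + s * (b - a)) - (a + t * (b - a))) = Rabs (s - t) * L).
{ intros s t. replace (a + s * (b - a) - (a + t * (b - a)))%C with (RtoC (s - t) * (b - a))%C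
    by (rewrite RtoC_minus; ring).
  rewrite Cmod_mult, Cmod_R. reflexivity. }
set (E := fun t => 0 <= t <= 1 /\
  forall s : R, 0 <= s <= t -> f (a + s * (b - a))%C = g (a + s * (b - a))%C).
assert (HEb : bound E) by (exists 1; intros t [Ht _]; lra).
assert (HE0 : E (Rmin (eps / 2) 1)).
{ pose proof (Rmin_l (eps / 2) 1). pose proof (Rmin_r (eps / 2) 1).
  assert (0 < Rmin (eps / 2) 1) by (apply Rmin_glb_lt; lra).
  split; [lra|]. intros s Hs. apply Hfg. lra. }
destruct (completeness E HEb (ex_intro _ _ HE0)) as [T [HTu HTl]].
assert (HT0 : 0 < T).
{ apply Rlt_le_trans with (2 := HTu _ HE0). apply Rmin_glb_lt; lra. }
assert (HT1 : T <= 1) by (apply HTl; intros t [Ht _]; lra).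
assert (Hlt : forall s : R, 0 <= s < T -> f (a + s * (b - a))%C = g (a + s * (b - a))%C).
{ intros s Hs. destruct (Classical_Prop.classic (exists t, E t /\ s <= t)) as [(t & [_ Ht] & Hst)|Hn].
  - apply Ht. lra.
  - exfalso. apply (Rlt_irrefl s). apply Rlt_le_trans with T; [lra|]. apply HTl. intros t Ht.
    apply Rnot_lt_le. intros Hst. apply Hn. exists t. split; [assumption|lra]. }
destruct (analytic_eq_near f g (a + T * (b - a))%C (Hf T ltac:(lra)) (Hg T ltac:(lra)))
  as (delta & Hdelta & Hball).
{ intros e He.
  set (s := Rmax 0 (T - e / (2 * L))).
  assert (He2 : 0 < e / (2 * L)) by (apply Rdiv_lt_0_compat; lra).
  assert (Hs : 0 <= s < T /\ T - s <= e / (2 * L)).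
  { unfold s, Rmax. destruct (Rle_dec 0 (T - e / (2 * L))); lra. }
  exists (a + s * (b - a))%C.
  assert (Hd : Cmod ((a + s * (b - a)) - (a + T * (b - a))) = (T - s) * L)
    by (rewrite Hdist, Rabs_left by lra; ring).
  split; [|split].
  - intros Hc. rewrite Hc in Hd. replace (a + T * (b - a) - (a + T * (b - a)))%C with (RtoC 0) in Hd by ring.
    rewrite Cmod_0 in Hd. nra.
  - rewrite Hd. apply Rle_lt_trans with (e / (2 * L) * L).
    + apply Rmult_le_compat_r; lra.
    + replace (e / (2 * L) * L) with (e / 2) by (field; lra). lra.
  - apply Hlt. lra. }
assert (Hnear : forall s : R, Rabs (s - T) < delta / L -> f (a + s * (b - a))%C = g (a + s * (b - a))%C).
{ intros s Hs. apply Hball. rewrite Hdist.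
  replace delta with (delta / L * L) by (field; lra). now apply Rmult_lt_compat_r. }
assert (HdL : 0 < delta / L) by now apply Rdiv_lt_0_compat.
destruct (Rle_lt_or_eq_dec T 1 HT1) as [HT|HT].
- exfalso. set (T' := Rmin 1 (T + delta / (2 * L))).
  assert (HdL2 : delta / (2 * L) = delta / L / 2) by (field; lra).
  assert (HT' : T < T' <= 1 /\ T' - T < delta / L).
  { unfold T', Rmin. destruct (Rle_dec 1 (T + delta / (2 * L))); lra. }
  assert (E T').
  { split; [lra|]. intros s Hs. destruct (Rlt_le_dec s T) as [H|H]; [apply Hlt; lra|].
    apply Hnear. rewrite Rabs_pos_eq; lra. }
  specialize (HTu T' H). lra.
- rewrite <- Eb. apply Hnear. rewrite HT, Rminus_diag, Rabs_R0. assumption.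
Qed.

(* The explicit geometric bound on the coefficients makes the class closed under
   the Cauchy product with a geometric series, i.e. under division by [z - w]. *)
Definition strongly_analytic_at (f : C -> C) (z0 : C) : Prop :=
  exists (c : nat -> C) (M rho : R), 0 < rho /\
    (forall n, Cmod (c n) <= M * rho ^ n) /\
    (forall z, rho * Cmod (z - z0) < 1 -> is_Cpseries c (z - z0)%C (f z)).

Lemma strongly_analytic_analytic f z0 :
  strongly_analytic_at f z0 -> analytic_at f z0.
Proof.
intros (c & M & rho & Hrho & _ & H). exists c. apply locally_C_ball.
exists (/ rho). split; [now apply Rinv_0_lt_compat|].
intros z Hz. apply H. apply (Rmult_lt_compat_l rho) in Hz; [|assumption].
now rewrite Rinv_r in Hz by lra.
Qed.

Lemma strongly_analytic_ext f g z0 :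
  (forall z, f z = g z) -> strongly_analytic_at f z0 -> strongly_analytic_at g z0.
Proof.
intros E (c & M & rho & Hrho & Hc & H). exists c, M, rho. repeat split; try assumption.
intros z Hz. rewrite <- E. now apply H.
Qed.

Definition const_coef (k : C) (n : nat) : C := match n with 0%nat => k | S _ => 0 end.

Lemma is_Cpseries_const k x : is_Cpseries (const_coef k) x k.
Proof.
apply is_pseries_C_iff. intros eps Heps. exists 0%nat. intros n _.
assert (E : psum (const_coef k) x n = k).
{ induction n as [|n IH]; [apply psum_0|]. rewrite psum_S, IH. simpl. ring. }
rewrite E. replace (k - k)%C with (RtoC 0) by ring. now rewrite Cmod_0.
Qed.

Lemma strongly_analytic_const k z0 : strongly_analytic_at (fun _ => k) z0.
Proof.
exists (const_coef k), (Cmod k), 1. split; [lra|]. split.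
- intros n. rewrite pow1, Rmult_1_r. destruct n; simpl; [lra|]. rewrite Cmod_0. apply Cmod_ge_0.
- intros z _. apply is_Cpseries_const.
Qed.

(** Expanding z as z0 + (z - z0) turns the product into a multiple of the series plus its shift; the
    shift accounts for M / rho in the new bound. *)
Lemma strongly_analytic_horner f k z0 :
  strongly_analytic_at f z0 -> strongly_analytic_at (fun z => k + z * f z)%C z0.
Proof.
intros (c & M & rho & Hrho & Hc & H).
assert (HM : 0 <= M) by (pose proof (Hc 0%nat); pose proof (Cmod_ge_0 (c 0%nat)); simpl in *; lra).
exists (fun n => const_coef k n + (z0 * c n + match n with 0%nat => RtoC 0 | S p => c p end))%C.
exists (Cmod k + (Cmod z0 * M + M / rho)), rho. split; [assumption|].
assert (HMr : 0 <= M / rho) by (apply Rdiv_le_0_compat; lra).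
split.
- intros n. assert (Hp : 0 < rho ^ n) by now apply pow_lt.
  eapply Rle_trans; [apply Cmod_triangle|]. rewrite (Rmult_plus_distr_r (Cmod k)).
  apply Rplus_le_compat.
  { destruct n; simpl; [lra|]. rewrite Cmod_0. apply Rmult_le_pos; [apply Cmod_ge_0|]. simpl in Hp. lra. }
  eapply Rle_trans; [apply Cmod_triangle|]. rewrite Rmult_plus_distr_r.
  apply Rplus_le_compat.
  + rewrite Cmod_mult, Rmult_assoc. apply Rmult_le_compat_l; [apply Cmod_ge_0|apply Hc].
  + destruct n as [|n].
    * rewrite Cmod_0. simpl. lra.
    * replace (M / rho * rho ^ S n) with (M * rho ^ n) by (simpl; field; lra). apply Hc.
- intros z Hz. specialize (H z Hz).
  pose proof (is_pseries_incr_1 (K := C_AbsRing) (V := C_NormedModule) _ _ _ H) as H1.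
  pose proof (is_pseries_scal (K := C_AbsRing) (V := C_NormedModule) z0 _ _ _ (Cmult_comm _ _) H) as H2.
  pose proof (is_pseries_plus (K := C_AbsRing) (V := C_NormedModule) _ _ _ _ _ H2 H1) as H3.
  pose proof (is_pseries_plus (K := C_AbsRing) (V := C_NormedModule) _ _ _ _ _ (is_Cpseries_const k (z - z0)%C) H3) as H4.
  replace (k + z * f z)%C with (k + (z0 * f z + (z - z0) * f z))%C by ring.
  exact H4.
Qed.

(* Coefficients of [s c(h) / (1 - r h)]. *)
Fixpoint geom_coef (r s : C) (c : nat -> C) (n : nat) : C :=
  match n with
  | 0%nat => (s * c 0%nat)%C
  | S p => (s * c (S p) + r * geom_coef r s c p)%C
  end.

(** With h = z - z0, s = 1 / (z0 - w) and r = - s, one has 1 / (z - w) = s / (1 - r h). The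
    coefficient of index n is a sum of n + 1 terms, each at most |s| M r1^n, and n + 1 <= 2^n
    restores a geometric bound, of ratio 2 r1. *)
Lemma strongly_analytic_div f w z0 :
  z0 <> w -> strongly_analytic_at f z0 ->
  strongly_analytic_at (fun z => f z / (z - w))%C z0.
Proof.
intros Hw (c & M & rho & Hrho & Hc & H).
assert (HM : 0 <= M) by (pose proof (Hc 0%nat); pose proof (Cmod_ge_0 (c 0%nat)); simpl in *; lra).
assert (Hw' : (z0 - w)%C <> 0) by now apply Cminus_eq_contra.
set (s := (/ (z0 - w))%C). set (r := (- s)%C).
set (r1 := Rmax rho (Cmod r)).
assert (Hr1 : rho <= r1) by apply Rmax_l.
assert (Hr2 : Cmod r <= r1) by apply Rmax_r.
pose proof (Cmod_ge_0 s) as Hs.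
assert (Hcr : Cmod r = Cmod s) by apply Cmod_opp.
set (d := geom_coef r s c).
assert (Hd : forall n, Cmod (d n) <= Cmod s * M * (INR n + 1) * r1 ^ n).
{ assert (Hc1 : forall n, Cmod (c n) <= M * r1 ^ n).
  { intros n. eapply Rle_trans; [apply Hc|]. apply Rmult_le_compat_l; [assumption|]. apply pow_incr. lra. }
  induction n as [|n IH].
  - unfold d; simpl geom_coef. rewrite Cmod_mult. pose proof (Hc1 0%nat). simpl in *.
    replace (Cmod s * M * (0 + 1) * 1) with (Cmod s * M) by ring. apply Rmult_le_compat_l; lra.
  - change (d (S n)) with (s * c (S n) + r * d n)%C.
    eapply Rle_trans; [apply Cmod_triangle|]. rewrite !Cmod_mult, S_INR.
    replace (Cmod s * M * (INR n + 1 + 1) * r1 ^ S n)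
      with (Cmod s * (M * r1 ^ S n) + r1 * (Cmod s * M * (INR n + 1) * r1 ^ n)) by (simpl; ring).
    apply Rplus_le_compat.
    + apply Rmult_le_compat_l; [assumption | apply Hc1].
    + apply Rmult_le_compat; try assumption; apply Cmod_ge_0. }
assert (Hd2 : forall n, Cmod (d n) <= Cmod s * M * (2 * r1) ^ n).
{ intros n. eapply Rle_trans; [apply Hd|]. rewrite Rpow_mult_distr, <- (Rmult_assoc _ (2 ^ n)).
  apply Rmult_le_compat_r; [apply pow_le; lra|].
  apply Rmult_le_compat_l; [now apply Rmult_le_pos|].
  clear. induction n as [|n IH]; [simpl; lra|]. rewrite S_INR. simpl.
  pose proof (pos_INR n). lra. }
exists d, (Cmod s * M), (2 * r1). split; [lra|]. split; [exact Hd2|].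
intros z Hz. set (h := (z - z0)%C) in *. pose proof (Cmod_ge_0 h) as Hh.
assert (Hfz : is_Cpseries c h (f z)) by (apply H; fold h; nra).
assert (Hrh : Cmod (r * h) < 1) by (rewrite Cmod_mult; nra).
assert (Hne : (1 - r * h)%C <> 0).
{ intros E. assert (E' : (r * h)%C = 1) by (symmetry; now apply Ceq_minus).
  rewrite E', Cmod_1 in Hrh. lra. }
assert (Ezw : (z - w = (z0 - w) * (1 - r * h))%C) by (unfold r, s, h; field; assumption).
(* The partial sums telescope after multiplication by 1 - r h. The remainder r d_n h^(n+1) is
   bounded by a constant times (2 r1 |h|)^n, which tends to 0. *)
assert (HS : forall n, (psum d h n * (1 - r * h) = s * psum c h n - r * d n * h ^ S n)%C).
{ induction n as [|n IH].
  - rewrite !psum_0. unfold d. simpl. ring.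
  - rewrite !psum_S, Cmult_plus_distr_r, IH.
    change (d (S n)) with (s * c (S n) + r * d n)%C. simpl. ring. }
apply is_pseries_C_iff. intros eps Heps.
set (A := Cmod (1 - r * h)). assert (HA : 0 < A) by now apply Cmod_gt_0.
assert (Hs0 : 0 < Cmod s).
{ apply Cmod_gt_0. intros E. apply C1_nz. rewrite <- (Cinv_r _ Hw'). fold s. rewrite E. ring. }
destruct (proj1 (is_pseries_C_iff _ _ _) Hfz (A * eps / 2 / Cmod s)) as [N1 HN1].
{ repeat apply Rdiv_lt_0_compat; nra. }
set (B := Cmod r * (Cmod s * M) * Cmod h).
assert (HB : 0 <= B) by (unfold B; repeat apply Rmult_le_pos; try assumption; lra).
destruct (pow_lt_1_zero (2 * r1 * Cmod h)) with (y := A * eps / 2 / (B + 1)) as [N2 HN2].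
{ rewrite Rabs_pos_eq; [assumption|]. apply Rmult_le_pos; lra. }
{ repeat apply Rdiv_lt_0_compat; nra. }
exists (Nat.max N1 N2). intros n Hn.
specialize (HN1 n ltac:(lia)). specialize (HN2 n ltac:(lia)).
apply Rmult_lt_reg_r with A; [assumption|]. unfold A at 1. rewrite <- Cmod_mult.
replace ((psum d h n - f z / (z - w)) * (1 - r * h))%C
  with (s * (psum c h n - f z) + - (r * d n * h ^ S n))%C.
2:{ unfold Cminus at 2. rewrite Cmult_plus_distr_r, HS, Ezw. unfold s. field.
    split; assumption. }
eapply Rle_lt_trans; [apply Cmod_triangle|]. rewrite Cmod_opp, !Cmod_mult, Cmod_pow.
assert (H1 : Cmod s * Cmod (psum c h n - f z) < A * eps / 2).
{ replace (A * eps / 2) with (Cmod s * (A * eps / 2 / Cmod s)) by (field; lra).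
  now apply Rmult_lt_compat_l. }
assert (H2 : Cmod r * Cmod (d n) * Cmod h ^ S n <= A * eps / 2).
{ rewrite Rabs_pos_eq in HN2 by (apply pow_le, Rmult_le_pos; lra).
  apply Rle_trans with (B * (2 * r1 * Cmod h) ^ n).
  - unfold B. rewrite (Rpow_mult_distr (2 * r1)).
    replace (Cmod r * (Cmod s * M) * Cmod h * ((2 * r1) ^ n * Cmod h ^ n))
      with (Cmod r * (Cmod s * M * (2 * r1) ^ n) * Cmod h ^ S n) by (simpl; ring).
    apply Rmult_le_compat_r; [apply pow_le; lra|].
    apply Rmult_le_compat_l; [lra|]. apply Hd2.
  - apply Rle_trans with (B * (A * eps / 2 / (B + 1))).
    + apply Rmult_le_compat_l; lra.
    + assert (Hae : 0 < A * eps / 2) by (apply Rdiv_lt_0_compat; nra).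
      replace (B * (A * eps / 2 / (B + 1))) with (A * eps / 2 * (B / (B + 1))) by (field; lra).
      rewrite <- (Rmult_1_r (A * eps / 2)) at 2. apply Rmult_le_compat_l; [lra|].
      apply Rmult_le_reg_r with (B + 1); [lra|]. unfold Rdiv. rewrite Rmult_assoc, Rinv_l by lra. lra. }
lra.
Qed.

(** * Complex-valued functions of a real variable, polynomials *)

Notation is_Cderive := (is_derive (K := R_AbsRing) (V := C_R_NormedModule)).
Notation is_CRInt := (is_RInt (V := C_R_NormedModule)).
Notation Ccontinuous := (continuous (U := C_R_NormedModule)).

Lemma is_Cderive_pair (f g : R -> R) (t df dg : R) :
  is_derive f t df -> is_derive g t dg ->
  is_Cderive (fun s => (f s, g s) : C) t (df, dg).
Proof.
intros Hf Hg.
pose proof (is_derive_scal_l (V := C_R_NormedModule) f t df ((1, 0) : C) Hf) as H1.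
pose proof (is_derive_scal_l (V := C_R_NormedModule) g t dg ((0, 1) : C) Hg) as H2.
pose proof (is_derive_plus (V := C_R_NormedModule) _ _ _ _ _ H1 H2) as H.
assert (E : forall a b : R, plus (G := C_R_NormedModule) (scal (V := C_R_NormedModule) a ((1, 0) : C))
   (scal (V := C_R_NormedModule) b ((0, 1) : C)) = (a, b)).
{ intros a b. apply injective_projections; simpl; unfold scal, plus, mult; simpl;
  unfold mult; simpl; ring. }
rewrite E in H. eapply is_derive_ext; [|exact H]. intros s. apply E.
Qed.

Lemma is_Cderive_Re (f : R -> C) (t : R) (l : C) :
  is_Cderive f t l -> is_derive (fun s => Re (f s)) t (Re l).
Proof.
intros H.
exact (filterdiff_comp' (U := R_NormedModule) (V := C_R_NormedModule) (W := R_NormedModule)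
  f fst t _ _ H (filterdiff_linear _ (is_linear_fst (U := R_NormedModule) (V := R_NormedModule)))).
Qed.

Lemma is_Cderive_Im (f : R -> C) (t : R) (l : C) :
  is_Cderive f t l -> is_derive (fun s => Im (f s)) t (Im l).
Proof.
intros H.
exact (filterdiff_comp' (U := R_NormedModule) (V := C_R_NormedModule) (W := R_NormedModule)
  f snd t _ _ H (filterdiff_linear _ (is_linear_snd (U := R_NormedModule) (V := R_NormedModule)))).
Qed.

Lemma is_Cderive_plus (f g : R -> C) (t : R) (df dg : C) :
  is_Cderive f t df -> is_Cderive g t dg -> is_Cderive (fun s => f s + g s)%C t (df + dg)%C.
Proof. apply (is_derive_plus (V := C_R_NormedModule)). Qed.

Lemma is_Cderive_const (k : C) (t : R) : is_Cderive (fun _ => k) t (RtoC 0).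
Proof. exact (is_derive_const (V := C_R_NormedModule) k t). Qed.

Lemma is_Cderive_RtoC (f : R -> R) (t df : R) :
  is_derive f t df -> is_Cderive (fun s => RtoC (f s)) t (RtoC df).
Proof. intros H. apply (is_Cderive_pair f (fun _ => 0) t df 0 H (is_derive_const 0 t)). Qed.

Lemma is_Cderive_id (t : R) : is_Cderive (fun s => RtoC s) t (RtoC 1).
Proof. apply (is_Cderive_RtoC (fun s => s)). exact (is_derive_id (K := R_AbsRing) t). Qed.

Lemma is_Cderive_mult (f g : R -> C) (t : R) (df dg : C) :
  is_Cderive f t df -> is_Cderive g t dg ->
  is_Cderive (fun s => f s * g s)%C t (df * g t + f t * dg)%C.
Proof.
intros Hf Hg.
pose proof (is_Cderive_Re _ _ _ Hf) as Hf1. pose proof (is_Cderive_Im _ _ _ Hf) as Hf2.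
pose proof (is_Cderive_Re _ _ _ Hg) as Hg1. pose proof (is_Cderive_Im _ _ _ Hg) as Hg2.
pose proof (fun f g df dg H1 H2 => is_derive_mult (K := R_AbsRing) f g t df dg H1 H2 Rmult_comm) as M.
pose proof (is_Cderive_pair _ _ _ _ _
  (is_derive_minus (K := R_AbsRing) (V := R_NormedModule) _ _ _ _ _ (M _ _ _ _ Hf1 Hg1) (M _ _ _ _ Hf2 Hg2))
  (is_derive_plus (K := R_AbsRing) (V := R_NormedModule) _ _ _ _ _ (M _ _ _ _ Hf1 Hg2) (M _ _ _ _ Hf2 Hg1))) as H.
match type of H with is_derive _ _ ?l => replace (df * g t + f t * dg)%C with (l : C) end.
- exact H.
- apply injective_projections; unfold minus, plus, opp, mult, Re, Im; simpl;
  unfold minus, plus, opp, mult; simpl; ring.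
Qed.

Lemma is_Cderive_scal (k : C) (f : R -> C) (t : R) (df : C) :
  is_Cderive f t df -> is_Cderive (fun s => k * f s)%C t (k * df)%C.
Proof.
intros H. pose proof (is_Cderive_mult _ _ _ _ _ (is_Cderive_const k t) H) as M.
replace (k * df)%C with (RtoC 0 * f t + k * df)%C by ring. exact M.
Qed.

Lemma is_Cderive_pow (f : R -> C) (t : R) (df : C) (n : nat) :
  is_Cderive f t df -> is_Cderive (fun s => f s ^ S n)%C t (INR (S n) * f t ^ n * df)%C.
Proof.
intros H. induction n as [|n IH].
- eapply is_derive_ext with (f := f). { intros s. symmetry. apply Cmult_1_r. }
  replace (INR 1 * f t ^ 0 * df)%C with df by (simpl; ring). exact H.
- pose proof (is_Cderive_mult _ _ _ _ _ H IH) as M.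
  replace (INR (S (S n)) * f t ^ S n * df)%C
    with (df * f t ^ S n + f t * (INR (S n) * f t ^ n * df))%C; [exact M|].
  rewrite (S_INR (S n)), RtoC_plus. simpl Cpow. ring.
Qed.

Lemma is_Cderive_continuous (f : R -> C) (t : R) (l : C) :
  is_Cderive f t l -> Ccontinuous f t.
Proof. intros H. apply (ex_derive_continuous (V := C_R_NormedModule)). now exists l. Qed.

Lemma is_CRInt_Cmult (k : C) (f : R -> C) (a b : R) (l : C) :
  is_CRInt f a b l -> is_CRInt (fun t => k * f t)%C a b (k * l)%C.
Proof.
intros H.
pose proof (is_RInt_fct_extend_fst (U := R_NormedModule) (V := R_NormedModule) f a b l H) as H1.
pose proof (is_RInt_fct_extend_snd (U := R_NormedModule) (V := R_NormedModule) f a b l H) as H2.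
apply (is_RInt_fct_extend_pair (U := R_NormedModule) (V := R_NormedModule)).
- exact (is_RInt_minus (V := R_NormedModule) _ _ _ _ _ _ (is_RInt_scal (V := R_NormedModule) _ _ _ (fst k) _ H1)
    (is_RInt_scal (V := R_NormedModule) _ _ _ (snd k) _ H2)).
- exact (is_RInt_plus (V := R_NormedModule) _ _ _ _ _ _ (is_RInt_scal (V := R_NormedModule) _ _ _ (fst k) _ H2)
    (is_RInt_scal (V := R_NormedModule) _ _ _ (snd k) _ H1)).
Qed.

Lemma is_CRInt_plus (f g : R -> C) (a b : R) (lf lg : C) :
  is_CRInt f a b lf -> is_CRInt g a b lg -> is_CRInt (fun t => f t + g t)%C a b (lf + lg)%C.
Proof. apply (is_RInt_plus (V := C_R_NormedModule)). Qed.

Lemma is_CRInt_RtoC (f : R -> R) (a b l : R) :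
  is_RInt f a b l -> is_CRInt (fun t => RtoC (f t)) a b (RtoC l).
Proof.
intros H. apply (is_RInt_fct_extend_pair (U := R_NormedModule) (V := R_NormedModule)).
- exact H.
- eapply is_RInt_ext with (f := fun _ => 0); [reflexivity|].
  pose proof (is_RInt_const (V := R_NormedModule) a b 0) as H0.
  match type of H0 with is_RInt _ _ _ ?l =>
    replace l with 0 in H0 by (symmetry; apply Rmult_0_r) end.
  exact H0.
Qed.

Lemma is_CRInt_unique (f : R -> C) (a b : R) (l l' : C) :
  is_CRInt f a b l -> is_CRInt f a b l' -> l = l'.
Proof.
intros H H'. rewrite <- (is_RInt_unique (V := C_R_CompleteNormedModule) f a b l H).
now apply (is_RInt_unique (V := C_R_CompleteNormedModule)).
Qed.

Lemma is_CRInt_derive (f df : R -> C) (a b : R) :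
  (forall t, Rmin a b <= t <= Rmax a b -> is_Cderive f t (df t)) ->
  (forall t, Rmin a b <= t <= Rmax a b -> Ccontinuous df t) ->
  is_CRInt df a b (f b - f a)%C.
Proof. apply (is_RInt_derive (V := C_R_CompleteNormedModule)). Qed.

(* Polynomials in [v] over [A], used for both C[z] and C[z][t]. *)
Inductive horner {X : Type} (A : (X -> C) -> Prop) (v : X -> C) : (X -> C) -> Prop :=
| horner_nil q f : A q -> (forall x, f x = q x) -> horner A v f
| horner_cons q g f : A q -> horner A v g -> (forall x, f x = q x + v x * g x)%C -> horner A v f.

Section Horner.
Context {X : Type} (A : (X -> C) -> Prop) (v : X -> C).
Hypothesis A_plus : forall q r, A q -> A r -> A (fun x => q x + r x)%C.
Hypothesis A_mult : forall q r, A q -> A r -> A (fun x => q x * r x)%C.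

Lemma horner_coef q : A q -> horner A v q.
Proof. intros H. now apply horner_nil with q. Qed.

Lemma horner_ext f g : (forall x, f x = g x) -> horner A v f -> horner A v g.
Proof.
intros E H. destruct H as [q f Hq H|q h f Hq Hh H].
- apply horner_nil with q; [assumption|]. intros x. now rewrite <- E.
- apply horner_cons with q h; try assumption. intros x. now rewrite <- E.
Qed.

Lemma horner_plus f g : horner A v f -> horner A v g -> horner A v (fun x => f x + g x)%C.
Proof.
intros Hf. revert g. induction Hf as [q f Hq Ef|q f' f Hq Hf' IH Ef]; intros g Hg.
- destruct Hg as [r g Hr Eg|r g' g Hr Hg' Eg].
  + apply horner_nil with (fun x => q x + r x)%C; [now apply A_plus|].
    intros x. now rewrite Ef, Eg.
  + apply horner_cons with (fun x => q x + r x)%C g'; [now apply A_plus|assumption|].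
    intros x. rewrite Ef, Eg. ring.
- destruct Hg as [r g Hr Eg|r g' g Hr Hg' Eg].
  + apply horner_cons with (fun x => q x + r x)%C f'; [now apply A_plus| |].
    * assumption.
    * intros x. rewrite Ef, Eg. ring.
  + apply horner_cons with (fun x => q x + r x)%C (fun x => f' x + g' x)%C;
      [now apply A_plus|now apply IH|].
    intros x. rewrite Ef, Eg. ring.
Qed.

Lemma horner_scal q f : A q -> horner A v f -> horner A v (fun x => q x * f x)%C.
Proof.
intros Hq Hf. induction Hf as [r f Hr Ef|r f' f Hr _ IH Ef].
- apply horner_nil with (fun x => q x * r x)%C; [now apply A_mult|].
  intros x. now rewrite Ef.
- apply horner_cons with (fun x => q x * r x)%C (fun x => q x * f' x)%C; [now apply A_mult|assumption|].
  intros x. rewrite Ef. ring.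
Qed.

Hypothesis A_0 : A (fun _ => RtoC 0).
Hypothesis A_1 : A (fun _ => RtoC 1).

Lemma horner_mult f g : horner A v f -> horner A v g -> horner A v (fun x => f x * g x)%C.
Proof.
intros Hf Hg. induction Hf as [q f Hq Ef|q f' f Hq _ IH Ef].
- apply horner_ext with (fun x => q x * g x)%C; [intros x; now rewrite Ef|].
  now apply horner_scal.
- apply horner_ext with (fun x => q x * g x + (0 + v x * (f' x * g x)))%C.
  + intros x. rewrite Ef. ring.
  + apply horner_plus; [now apply horner_scal|].
    now apply horner_cons with (fun _ => RtoC 0) (fun x => f' x * g x)%C.
Qed.

Lemma horner_var : horner A v v.
Proof.
apply horner_cons with (fun _ => RtoC 0) (fun _ => RtoC 1); [assumption|now apply horner_coef|].
intros x. ring.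
Qed.

Lemma horner_pow f n : horner A v f -> horner A v (fun x => f x ^ n)%C.
Proof.
intros Hf. induction n as [|n IH].
- now apply horner_coef.
- simpl. now apply horner_mult.
Qed.
End Horner.

Definition constant {X : Type} (f : X -> C) : Prop := exists k, forall x, f x = k.

Lemma constant_plus {X : Type} (q r : X -> C) :
  constant q -> constant r -> constant (fun x => q x + r x)%C.
Proof. intros [k Hk] [l Hl]. exists (k + l)%C. intros x. now rewrite Hk, Hl. Qed.

Lemma constant_mult {X : Type} (q r : X -> C) :
  constant q -> constant r -> constant (fun x => q x * r x)%C.
Proof. intros [k Hk] [l Hl]. exists (k * l)%C. intros x. now rewrite Hk, Hl. Qed.

Lemma constant_const {X : Type} k : constant (fun _ : X => k).
Proof. now exists k. Qed.

Definition polynomial : (C -> C) -> Prop := horner constant (fun z => z).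

Lemma polynomial_strongly_analytic f z0 : polynomial f -> strongly_analytic_at f z0.
Proof.
intros Hf. induction Hf as [q f [k Hk] Ef|q f' f [k Hk] _ IH Ef].
- apply strongly_analytic_ext with (fun _ => k); [intros z; now rewrite Ef, Hk|].
  apply strongly_analytic_const.
- apply strongly_analytic_ext with (fun z => k + z * f' z)%C; [intros z; now rewrite Ef, Hk|].
  now apply strongly_analytic_horner.
Qed.

Lemma RtoC_INR_S_neq_0 n : RtoC (INR (S n)) <> 0.
Proof. intros E. apply RtoC_inj in E. revert E. apply not_0_INR. lia. Qed.

(** The primitive is expressed through the chain rule along an arbitrary real-parameter path, so
    that one [Phi] can later be evaluated on two different paths. The auxiliary power u^k absorbs
    the shift made by each Horner step. *)
Lemma polynomial_primitive g : polynomial g ->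
  exists Phi : C -> C, forall (u : R -> C) (t : R) (du : C),
    is_Cderive u t du -> is_Cderive (fun s => Phi (u s)) t (g (u t) * du)%C.
Proof.
intros Hg.
assert (H : forall k, exists Phi : C -> C, forall (u : R -> C) (t : R) (du : C),
    is_Cderive u t du -> is_Cderive (fun s => Phi (u s)) t (u t ^ k * g (u t) * du)%C).
{ assert (Hc : forall (c : C) k (u : R -> C) (t : R) (du : C), is_Cderive u t du ->
    is_Cderive (fun s => c / INR (S k) * u s ^ S k)%C t (u t ^ k * c * du)%C).
  { intros c k u t du Hu.
    replace (u t ^ k * c * du)%C with (c / INR (S k) * (INR (S k) * u t ^ k * du))%C
      by (field; apply RtoC_INR_S_neq_0).
    now apply is_Cderive_scal, is_Cderive_pow. }
  induction Hg as [q g [c Ec] Eg|q g' g [c Ec] _ IH Eg]; intros k.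
  - exists (fun z => c / INR (S k) * z ^ S k)%C. intros u t du Hu. rewrite Eg, Ec. now apply Hc.
  - destruct (IH (S k)) as [Phi HPhi].
    exists (fun z => c / INR (S k) * z ^ S k + Phi z)%C. intros u t du Hu.
    replace (u t ^ k * g (u t) * du)%C
      with (u t ^ k * c * du + u t ^ S k * g' (u t) * du)%C by (rewrite Eg, Ec; simpl; ring).
    apply is_Cderive_plus; [now apply Hc|now apply HPhi]. }
destruct (H 0%nat) as [Phi HPhi]. exists Phi. intros u t du Hu.
replace (g (u t) * du)%C with (u t ^ 0 * g (u t) * du)%C by (simpl; ring). now apply HPhi.
Qed.

Definition lift_fst (q : C * R -> C) : Prop := exists r, polynomial r /\ forall x, q x = r (fst x).

Definition polynomial2 : (C * R -> C) -> Prop := horner lift_fst (fun x => RtoC (snd x)).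

(** Each power t^k contributes the factor 1 / (k + 1), so the integral is again polynomial in z.
    Analyticity in the parameter follows without differentiation under the integral sign. *)
Lemma polynomial2_integral f : polynomial2 f ->
  exists q, polynomial q /\ forall z, is_CRInt (fun t => f (z, t)) 0 1 (q z).
Proof.
intros Hf.
assert (H : forall k, exists q, polynomial q /\
  forall z, is_CRInt (fun t => t ^ k * f (z, t))%C 0 1 (q z)).
{ assert (Hc : forall (c : C) k, is_CRInt (fun t => t ^ k * c)%C 0 1 (/ INR (S k) * c)%C).
  { intros c k.
    replace (/ INR (S k) * c)%C
      with (c / INR (S k) * RtoC 1 ^ S k - c / INR (S k) * RtoC 0 ^ S k)%C
      by (rewrite Cpow_1_l; simpl Cpow; field; apply RtoC_INR_S_neq_0).
    pose proof (is_CRInt_derive (fun t => c / INR (S k) * t ^ S k)%C (fun t => t ^ k * c)%C 0 1) as D.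
    apply D.
    - intros t _.
      replace (t ^ k * c)%C with (c / INR (S k) * (INR (S k) * t ^ k * 1))%C
        by (field; apply RtoC_INR_S_neq_0).
      apply is_Cderive_scal. apply (is_Cderive_pow (fun s => RtoC s)), is_Cderive_id.
    - intros t _. destruct k as [|k].
      + eapply is_Cderive_continuous. simpl. apply is_Cderive_const.
      + eapply is_Cderive_continuous. apply is_Cderive_mult; [|apply is_Cderive_const].
        apply (is_Cderive_pow (fun s => RtoC s)), is_Cderive_id. }
  induction Hf as [q f [r [Hr Er]] Ef|q f' f [r [Hr Er]] _ IH Ef]; intros k.
  - exists (fun z => / INR (S k) * r z)%C. split.
    + apply horner_scal; [apply constant_mult|apply constant_const|assumption].
    + intros z. apply (is_RInt_ext (V := C_R_NormedModule) (fun t => t ^ k * r z)%C).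
      * intros t _. now rewrite Ef, Er.
      * apply Hc.
  - destruct (IH (S k)) as (q' & Hq' & H').
    exists (fun z => / INR (S k) * r z + q' z)%C. split.
    + apply horner_plus; [apply constant_plus| |assumption].
      apply horner_scal; [apply constant_mult|apply constant_const|assumption].
    + intros z. apply (is_RInt_ext (V := C_R_NormedModule) (fun t => t ^ k * r z + t ^ S k * f' (z, t))%C).
      * intros t _. rewrite Ef, Er. simpl. change (r z) with (r (fst (z, t))). simpl.
        match goal with |- ?a = ?b => change a with (t ^ k * r z + t * t ^ k * f' (z, t))%C end. ring.
      * apply is_CRInt_plus; [apply Hc|apply H']. }
destruct (H 0%nat) as (q & Hq & Hi). exists q. split; [assumption|]. intros z.
eapply (is_RInt_ext (V := C_R_NormedModule)); [|apply Hi]. intros t _. simpl.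
match goal with |- ?a = ?b => change a with (1 * f (z, t))%C end. ring.
Qed.

(** * The continuation of I_m *)

(** Off the cut the real part of the root is positive, and the imaginary part is recovered from 2 Re
    Im = Im w. This form has no sign test, so it can be differentiated across the positive real
    axis. *)
Lemma slit_plane_Csqrt (w : C) : slit_plane w ->
  0 < Cmod w + Re w /\ 0 < Re (Csqrt w) /\ Im (Csqrt w) = Im w / (2 * Re (Csqrt w)).
Proof.
intros Hw.
assert (H : 0 < Cmod w + Re w).
{ pose proof (Re_le_Cmod w) as H1. pose proof (Cmod2_alt w) as H2. simpl in H2.
  destruct (Req_dec (Im w) 0) as [Hi|Hi].
  - destruct (Rle_lt_dec (Re w) 0) as [Hr|Hr]; [now elim Hw|]. lra.
  - assert (0 < Im w * Im w) by (apply Rlt_0_sqr; assumption). nra. }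
assert (Hp : 0 < Re (Csqrt w)) by (simpl; apply sqrt_lt_R0; lra).
repeat split; try assumption.
pose proof (f_equal Im (Csqrt_sq w)) as E.
set (r := Csqrt w) in *. clearbody r. destruct r as [x y]. simpl in *. rewrite <- E. field. lra.
Qed.

(** Differentiability comes from the real formulas for the two components, valid on a neighbourhood
    of t; the value of the derivative is then read off by differentiating the square of the root. *)
Lemma is_Cderive_Csqrt (v : R -> C) (t : R) (dv : C) :
  slit_plane (v t) -> is_Cderive v t dv ->
  is_Cderive (fun s => Csqrt (v s)) t (dv / (2 * Csqrt (v t)))%C.
Proof.
intros Hs Hv.
destruct (slit_plane_Csqrt _ Hs) as (Hpos & Hre & _).
pose proof (is_Cderive_Re _ _ _ Hv) as HX. pose proof (is_Cderive_Im _ _ _ Hv) as HY.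
set (X := fun s => Re (v s)) in HX. set (Y := fun s => Im (v s)) in HY.
assert (EX : ex_derive X t) by (eexists; exact HX).
assert (EY : ex_derive Y t) by (eexists; exact HY).
set (N := fun s => (sqrt (X s ^ 2 + Y s ^ 2) + X s) / 2).
assert (HN : forall s, N s = (Cmod (v s) + Re (v s)) / 2) by reflexivity.
assert (HNt : 0 < N t) by (rewrite HN; lra).
assert (Hnz : 0 < X t ^ 2 + Y t ^ 2).
{ apply sqrt_lt_0_alt. rewrite sqrt_0. change (0 < Cmod (v t)).
  pose proof (Re_le_Cmod (v t)). lra. }
assert (EN : ex_derive N t) by (unfold N; auto_derive; auto).
set (r := fun s => sqrt (N s)).
assert (Er : ex_derive r t) by (unfold r; auto_derive; auto).
assert (Hrt : 0 < r t) by now apply sqrt_lt_R0.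
assert (Ei : ex_derive (fun s => Y s / (2 * r s)) t).
{ auto_derive. repeat split; try assumption. lra. }
destruct Er as [dr Hdr]. destruct Ei as [di Hdi].
assert (H : exists l : C, is_Cderive (fun s => Csqrt (v s)) t l).
{ exists (dr, di). eapply is_derive_ext_loc; [|exact (is_Cderive_pair _ _ _ _ _ Hdr Hdi)].
  assert (HL : locally t (fun s => 0 < N s)).
  { apply (ex_derive_continuous N t EN). now apply open_gt. }
  revert HL. apply filter_imp. intros s Hss.
  assert (Hsl : slit_plane (v s)).
  { intros [Hi Hr]. rewrite HN in Hss. pose proof (Cmod2_alt (v s)) as H2.
    rewrite Hi in H2. pose proof (Cmod_ge_0 (v s)). simpl in H2. nra. }
  destruct (slit_plane_Csqrt _ Hsl) as (_ & _ & Him).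
  apply injective_projections; [reflexivity|]. symmetry. exact Him. }
destruct H as [l H].
pose proof (is_Cderive_mult _ _ _ _ _ H H) as Hm.
assert (Hm' : is_Cderive v t (l * Csqrt (v t) + Csqrt (v t) * l)%C).
{ eapply is_derive_ext; [|exact Hm]. intros s. apply Csqrt_sq. }
assert (E : (l * Csqrt (v t) + Csqrt (v t) * l)%C = dv).
{ apply injective_projections.
  - exact (eq_trans (eq_sym (is_derive_unique _ _ _ (is_Cderive_Re _ _ _ Hm')))
      (is_derive_unique _ _ _ (is_Cderive_Re _ _ _ Hv))).
  - exact (eq_trans (eq_sym (is_derive_unique _ _ _ (is_Cderive_Im _ _ _ Hm')))
      (is_derive_unique _ _ _ (is_Cderive_Im _ _ _ Hv))). }
assert (Hn0 : Csqrt (v t) <> 0) by (intros E0; rewrite E0 in Hre; simpl in Hre; lra).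
replace (dv / (2 * Csqrt (v t)))%C with l; [exact H|].
rewrite <- E. field. assumption.
Qed.

Lemma ex_Cderive_inv (u : R -> C) (t : R) (du : C) :
  u t <> 0 -> is_Cderive u t du -> exists l : C, is_Cderive (fun s => / u s)%C t l.
Proof.
intros Hu H.
pose proof (is_Cderive_Re _ _ _ H) as HX. pose proof (is_Cderive_Im _ _ _ H) as HY.
set (X := fun s => Re (u s)) in HX. set (Y := fun s => Im (u s)) in HY.
assert (EX : ex_derive X t) by (eexists; exact HX).
assert (EY : ex_derive Y t) by (eexists; exact HY).
assert (Hnz : X t ^ 2 + Y t ^ 2 <> 0).
{ intros E. apply Hu, Cmod_eq_0. unfold Cmod. fold (Re (u t)) (Im (u t)).
  change (Re (u t)) with (X t). change (Im (u t)) with (Y t). rewrite E. apply sqrt_0. }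
assert (E1 : ex_derive (fun s => X s / (X s ^ 2 + Y s ^ 2)) t) by (auto_derive; auto).
assert (E2 : ex_derive (fun s => - Y s / (X s ^ 2 + Y s ^ 2)) t) by (auto_derive; auto).
destruct E1 as [l1 H1]. destruct E2 as [l2 H2]. exists (l1, l2).
exact (is_Cderive_pair _ _ _ _ _ H1 H2).
Qed.

Lemma ex_Cderive_pow (f : R -> C) (t : R) (df : C) (n : nat) :
  is_Cderive f t df -> exists l : C, is_Cderive (fun s => f s ^ n)%C t l.
Proof.
intros H. destruct n as [|n].
- exists (RtoC 0). exact (is_Cderive_const (RtoC 1) t).
- eexists. exact (is_Cderive_pow f t df n H).
Qed.

(** This is (u^2 - 1)(z^2 - u^2) / (z - 1)^2 at u = 1 + (z - 1) t. Removing the factor (z - 1)^2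
    keeps the integral meaningful and nonzero at z = 1. *)
Definition qpoly (z : C) (t : R) : C :=
  (t * (1 - t) * (2 + (z - 1) * t) * (z + 1 + (z - 1) * t))%C.

Definition upath (z : C) (t : R) : C := (1 + (z - 1) * t)%C.

Definition Q (m : nat) (z : C) : C :=
  RInt (V := C_R_CompleteNormedModule) (fun t => qpoly z t ^ m)%C 0 1.

Definition Q2 (m : nat) (z : C) : C :=
  RInt (V := C_R_CompleteNormedModule) (fun t => upath z t ^ 2 * qpoly z t ^ m)%C 0 1.

Lemma lift_fst_plus q r : lift_fst q -> lift_fst r -> lift_fst (fun x => q x + r x)%C.
Proof.
intros (f & Hf & Ef) (g & Hg & Eg). exists (fun z => f z + g z)%C. split.
- apply horner_plus; [apply constant_plus|assumption|assumption].
- intros x. now rewrite Ef, Eg.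
Qed.

Lemma lift_fst_mult q r : lift_fst q -> lift_fst r -> lift_fst (fun x => q x * r x)%C.
Proof.
intros (f & Hf & Ef) (g & Hg & Eg). exists (fun z => f z * g z)%C. split.
- apply horner_mult; try assumption; try apply constant_const;
    [apply constant_plus|apply constant_mult].
- intros x. now rewrite Ef, Eg.
Qed.

Lemma lift_fst_const k : lift_fst (fun _ => k).
Proof. exists (fun _ => k). split; [apply horner_coef, constant_const|reflexivity]. Qed.

Lemma polynomial2_plus f g : polynomial2 f -> polynomial2 g -> polynomial2 (fun x => f x + g x)%C.
Proof. apply horner_plus, lift_fst_plus. Qed.

Lemma polynomial2_mult f g : polynomial2 f -> polynomial2 g -> polynomial2 (fun x => f x * g x)%C.
Proof. apply horner_mult; [apply lift_fst_plus|apply lift_fst_mult|apply lift_fst_const]. Qed.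

Lemma polynomial2_const k : polynomial2 (fun _ => k).
Proof. apply horner_coef, lift_fst_const. Qed.

Lemma polynomial2_fst : polynomial2 (fun x => fst x).
Proof.
apply horner_coef. exists (fun z => z). split; [|reflexivity].
apply horner_var; apply constant_const.
Qed.

Lemma polynomial2_snd : polynomial2 (fun x => RtoC (snd x)).
Proof. apply horner_var; apply lift_fst_const. Qed.

Lemma polynomial2_pow f n : polynomial2 f -> polynomial2 (fun x => f x ^ n)%C.
Proof.
apply horner_pow; [apply lift_fst_plus|apply lift_fst_mult|apply lift_fst_const|apply lift_fst_const].
Qed.

Lemma polynomial2_minus f g : polynomial2 f -> polynomial2 g -> polynomial2 (fun x => f x - g x)%C.
Proof.
intros Hf Hg. apply horner_ext with (fun x => f x + RtoC (-1) * g x)%C.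
- intros x. ring.
- apply polynomial2_plus; [assumption|]. apply polynomial2_mult; [apply polynomial2_const|assumption].
Qed.

Lemma polynomial2_upath : polynomial2 (fun x => upath (fst x) (snd x)).
Proof.
unfold upath.
repeat first [apply polynomial2_plus | apply polynomial2_mult | apply polynomial2_minus
  | apply polynomial2_const | apply polynomial2_fst | apply polynomial2_snd].
Qed.

Lemma polynomial2_qpoly : polynomial2 (fun x => qpoly (fst x) (snd x)).
Proof.
unfold qpoly.
repeat first [apply polynomial2_const | apply polynomial2_fst | apply polynomial2_snd
  | apply polynomial2_minus | apply polynomial2_plus | apply polynomial2_mult].
Qed.

Lemma Q_spec m : exists q, polynomial q /\ forall z, q z = Q m z /\
  is_CRInt (fun t => qpoly z t ^ m)%C 0 1 (Q m z).
Proof.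
destruct (polynomial2_integral _ (polynomial2_pow _ m polynomial2_qpoly)) as (q & Hq & Hi).
exists q. split; [assumption|]. intros z. specialize (Hi z). simpl in Hi.
assert (E : Q m z = q z) by exact (is_RInt_unique (V := C_R_CompleteNormedModule) _ _ _ _ Hi).
split; [now symmetry|]. rewrite E. exact Hi.
Qed.

Lemma Q_int m z : is_CRInt (fun t => qpoly z t ^ m)%C 0 1 (Q m z).
Proof. destruct (Q_spec m) as (q & _ & H). apply H. Qed.

Lemma Q2_int m z : is_CRInt (fun t => upath z t ^ 2 * qpoly z t ^ m)%C 0 1 (Q2 m z).
Proof.
destruct (polynomial2_integral _ (polynomial2_mult _ _ (polynomial2_pow _ 2 polynomial2_upath)
  (polynomial2_pow _ m polynomial2_qpoly))) as (q & Hq & Hi).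
specialize (Hi z). exact (RInt_correct (V := C_R_CompleteNormedModule) _ _ _ (ex_intro _ _ Hi)).
Qed.

Definition I_rat (m : nat) (z : C) : C := (2 * Q m z / (z + 1) ^ (2 * m + 1))%C.

Lemma Cinv_0 : (/ 0)%C = 0.
Proof. unfold Cinv. simpl. rewrite Ropp_0, !Rdiv_0_l. reflexivity. Qed.

Lemma I_rat_strongly_analytic m z0 : (z0 + 1)%C <> 0 -> strongly_analytic_at (I_rat m) z0.
Proof.
intros Hz. assert (H : forall n, strongly_analytic_at (fun z => 2 * Q m z / (z + 1) ^ n)%C z0).
{ induction n as [|n IH].
  - destruct (Q_spec m) as (q & Hq & E).
    apply strongly_analytic_ext with (fun z => 2 * q z)%C.
    + intros z. destruct (E z) as [-> _]. simpl. field.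
    + apply polynomial_strongly_analytic. apply horner_scal; [apply constant_mult|apply constant_const|assumption].
  - eapply strongly_analytic_ext; [|apply strongly_analytic_div with (w := RtoC (-1)); [|exact IH]].
    + intros z. cbv beta. simpl Cpow.
      assert (Ez : (z - RtoC (-1))%C = (z + 1)%C) by ring. rewrite Ez.
      (* The two functions must agree everywhere, the pole included; there both sides vanish because
         the inverse of 0 is 0. *)
      destruct (Ceq_dec (z + 1) 0) as [E|E].
      * rewrite E, Cmult_0_l. unfold Cdiv. rewrite Cinv_0. ring.
      * field. split; [now apply Cpow_nz|assumption].
    + intros E. apply Hz. rewrite E. ring. }
apply H.
Qed.

Definition W (z u : C) : C := ((u ^ 2 - 1) * (z ^ 2 - u ^ 2))%C.

Lemma W_polynomial_primitive m z :
  exists Phi : C -> C, forall (u : R -> C) (t : R) (du : C),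
    is_Cderive u t du -> is_Cderive (fun s => Phi (u s)) t (W z (u t) ^ m * du)%C.
Proof.
apply (polynomial_primitive (fun u => W z u ^ m)%C).
assert (Hid : polynomial (fun u => u)) by (apply horner_var; apply constant_const).
assert (HM : forall f g, polynomial f -> polynomial g -> polynomial (fun u => f u * g u)%C)
  by (intros f g; apply horner_mult; try apply constant_const; [apply constant_plus|apply constant_mult]).
assert (HP : forall f g, polynomial f -> polynomial g -> polynomial (fun u => f u + g u)%C)
  by (intros f g; apply horner_plus, constant_plus).
assert (HC : forall k, polynomial (fun _ => k)) by (intros k; apply horner_coef, constant_const).
apply horner_pow; try apply constant_const; [apply constant_plus|apply constant_mult|].
apply horner_ext with (fun u => (u * u + RtoC (-1)) * (z ^ 2 + RtoC (-1) * (u * u)))%C.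
{ intros u. unfold W. ring. }
apply HM; apply HP; repeat (apply HM || apply HC || assumption).
Qed.

Lemma is_Cderive_upath z t : is_Cderive (upath z) t (z - 1)%C.
Proof.
replace (z - 1)%C with (0 + (z - 1) * 1)%C by ring. unfold upath.
apply is_Cderive_plus; [apply is_Cderive_const|]. apply is_Cderive_scal, is_Cderive_id.
Qed.

Lemma W_upath z t : W z (upath z t) = ((z - 1) ^ 2 * qpoly z t)%C.
Proof. unfold W, upath, qpoly. ring. Qed.

(** Write z = a + i b. If the imaginary part 2 a b x vanishes with x <> 0, then b = 0 and the real
    part is (1 - x) + a^2 x > 0. *)
Lemma slit_plane_segment_sq (z : C) (x : R) :
  0 < Re z -> 0 <= x <= 1 -> slit_plane (1 + (z ^ 2 - 1) * x)%C.
Proof.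
intros Hz Hx [Hi Hr]. destruct z as [a b]. simpl in *.
assert (E : a * b * x = 0) by lra.
assert (Hb : b * x = 0) by nra.
destruct (Req_dec x 0) as [->|Hx0]; [lra|].
assert (b = 0) by nra. subst b.
assert (0 < a * a) by nra. nra.
Qed.

Lemma Csqrt_of_sq (z : C) : 0 < Re z -> Csqrt (z ^ 2) = z.
Proof.
intros Hz.
assert (E : ((Csqrt (z ^ 2) - z) * (Csqrt (z ^ 2) + z))%C = 0).
{ transitivity (Csqrt (z ^ 2) * Csqrt (z ^ 2) - z ^ 2)%C; [ring|]. rewrite Csqrt_sq. ring. }
assert (Hn : (Csqrt (z ^ 2) + z)%C <> 0).
{ intros E2. apply (f_equal Re) in E2.
  assert (E3 : Re (Csqrt (z ^ 2)) + Re z = 0) by exact E2.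
  destruct (Csqrt_principal (z ^ 2)) as [H|[H _]]; lra. }
apply Ceq_minus. destruct (Ceq_dec (Csqrt (z ^ 2) - z) 0) as [H|H]; [assumption|].
now elim (Cmult_neq_0 _ _ H Hn).
Qed.

Lemma Csqrt_1 : Csqrt 1 = 1.
Proof.
replace (RtoC 1) with (RtoC 1 ^ 2)%C at 1 by ring. apply Csqrt_of_sq. simpl. lra.
Qed.

(** Both paths from 1 to z collapse to a point here, and the general argument divides by z^2 - 1;
    but the square root is constantly 1 and [qpoly] is 4 t (1 - t). *)
Lemma I_integral_I_rat_1 m : I_integral m 1 = I_rat m 1.
Proof.
pose proof (is_CRInt_Cmult (/ 4 ^ m)%C _ _ _ _ (Q_int m 1)) as H.
assert (H4 : (4 ^ m)%C <> 0) by (apply Cpow_nz; intros E; apply RtoC_inj in E; lra).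
transitivity (/ 4 ^ m * Q m 1)%C.
- apply (is_RInt_unique (V := C_R_CompleteNormedModule)).
  eapply (is_RInt_ext (V := C_R_NormedModule)); [|exact H].
  intros x _.
  match goal with |- ?a = _ => change a with (/ 4 ^ m * qpoly 1 x ^ m)%C end.
  replace (1 + (1 ^ 2 - 1) * x)%C with (RtoC 1) by ring. rewrite Csqrt_1.
  replace (qpoly 1 x) with (4 * (x * (1 - x)))%C by (unfold qpoly; ring).
  rewrite RtoC_mult, !RtoC_pow, RtoC_minus, Cpow_mult_l, Cpow_mult_l.
  match goal with |- ?a = ?b => change (@eq C a b) end. field. assumption.
- unfold I_rat. replace (1 + 1)%C with (RtoC 2) by ring.
  rewrite Cpow_add_r, Cpow_mult_r. replace (2 ^ 2)%C with (RtoC 4) by ring.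
  simpl Cpow. field. assumption.
Qed.

(** The segment and the path x -> sqrt (1 + (z^2 - 1) x) both join 1 to z and both pull back the
    polynomial form W^m du, so each integral is a multiple of Phi z - Phi 1. On the segment, W
    contributes (z - 1)^(2m) and du one more factor z - 1. *)
Lemma I_integral_I_rat m z : 0 < Re z -> I_integral m z = I_rat m z.
Proof.
intros Hz.
destruct (Ceq_dec z 1) as [->|Hz1]; [apply I_integral_I_rat_1|].
assert (Hm1 : (z - 1)%C <> 0) by now apply Cminus_eq_contra.
assert (Hp1 : (z + 1)%C <> 0).
{ intros E. apply (f_equal Re) in E. change (Re z + 1 = 0) in E. lra. }
assert (Hd : (z ^ 2 - 1)%C <> 0).
{ replace (z ^ 2 - 1)%C with ((z - 1) * (z + 1))%C by ring. now apply Cmult_neq_0. }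
destruct (W_polynomial_primitive m z) as [Phi HPhi].
assert (EQ : ((z - 1) ^ (2 * m + 1) * Q m z = Phi z - Phi 1)%C).
{ eapply is_CRInt_unique; [apply is_CRInt_Cmult, Q_int|].
  assert (E1 : upath z 1 = z) by (unfold upath; ring).
  assert (E0 : upath z 0 = 1) by (unfold upath; ring).
  replace (Phi z - Phi 1)%C with (Phi (upath z 1) - Phi (upath z 0))%C by now rewrite E0, E1.
  apply (is_CRInt_derive (fun t => Phi (upath z t))).
  - intros t _.
    replace ((z - 1) ^ (2 * m + 1) * qpoly z t ^ m)%C with (W z (upath z t) ^ m * (z - 1))%C.
    + exact (HPhi (upath z) t _ (is_Cderive_upath z t)).
    + rewrite W_upath, Cpow_mult_l, Cpow_add_r, Cpow_mult_r. simpl. ring.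
  - intros t _.
    assert (Hq : exists l : C, is_Cderive (qpoly z) t l).
    { eexists. unfold qpoly. apply is_Cderive_mult; [apply is_Cderive_mult; [apply is_Cderive_mult|]|].
      - apply is_Cderive_id.
      - unfold Cminus. apply is_Cderive_plus; [apply is_Cderive_const|].
        apply (is_derive_opp (V := C_R_NormedModule)), is_Cderive_id.
      - apply is_Cderive_plus; [apply is_Cderive_const|]. apply is_Cderive_scal, is_Cderive_id.
      - apply is_Cderive_plus; [apply is_Cderive_const|]. apply is_Cderive_scal, is_Cderive_id. }
    destruct Hq as [l Hq].
    destruct (ex_Cderive_pow (qpoly z) t l m Hq) as [l' Hl'].
    exact (is_Cderive_continuous _ _ _ (is_Cderive_scal _ _ _ _ Hl')). }
set (v := fun x : R => (1 + (z ^ 2 - 1) * x)%C).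
assert (Hv : forall x, is_Cderive v x (z ^ 2 - 1)%C).
{ intros x. replace (z ^ 2 - 1)%C with (0 + (z ^ 2 - 1) * 1)%C by ring. unfold v.
  apply is_Cderive_plus; [apply is_Cderive_const|]. apply is_Cderive_scal, is_Cderive_id. }
assert (Hu : forall x, 0 <= x <= 1 ->
  is_Cderive (fun x => Csqrt (v x)) x ((z ^ 2 - 1) / (2 * Csqrt (v x)))%C /\ Csqrt (v x) <> 0).
{ intros x Hx. pose proof (slit_plane_segment_sq z x Hz Hx) as Hs. split.
  - now apply is_Cderive_Csqrt.
  - destruct (slit_plane_Csqrt _ Hs) as (_ & Hre & _). intros E. fold (v x) in Hre.
    rewrite E in Hre. simpl in Hre. lra. }
(* For u^2 = 1 + (z^2 - 1) x one has W = (z^2 - 1)^2 x (1 - x) and du = (z^2 - 1) / (2 u) dx, so W^m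
   du is the integrand of I_m times (z^2 - 1)^(2m+1) / 2. *)
transitivity (2 / (z ^ 2 - 1) ^ (2 * m + 1) * (Phi z - Phi 1))%C.
- apply (is_RInt_unique (V := C_R_CompleteNormedModule)).
  replace (2 / (z ^ 2 - 1) ^ (2 * m + 1) * (Phi z - Phi 1))%C
    with (2 / (z ^ 2 - 1) ^ (2 * m + 1) * Phi (Csqrt (v 1)) - 2 / (z ^ 2 - 1) ^ (2 * m + 1) * Phi (Csqrt (v 0)))%C.
  2:{ replace (v 1) with (z ^ 2)%C by (unfold v; ring). replace (v 0) with (RtoC 1) by (unfold v; ring).
      rewrite Csqrt_of_sq, Csqrt_1 by assumption. ring. }
  apply (is_CRInt_derive (fun x => 2 / (z ^ 2 - 1) ^ (2 * m + 1) * Phi (Csqrt (v x)))%C);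
    intros x; rewrite Rmin_left, Rmax_right by lra; intros Hx; destruct (Hu x Hx) as [Hux Hn].
  + replace (RtoC (x ^ m * (1 - x) ^ m) / Csqrt (1 + (z ^ 2 - 1) * x))%C
      with (2 / (z ^ 2 - 1) ^ (2 * m + 1) * (W z (Csqrt (v x)) ^ m * ((z ^ 2 - 1) / (2 * Csqrt (v x)))))%C.
    * apply (is_Cderive_scal _ (fun x => Phi (Csqrt (v x)))).
      exact (HPhi (fun x => Csqrt (v x)) x _ Hux).
    * fold (v x).
      replace (W z (Csqrt (v x))) with ((z ^ 2 - 1) ^ 2 * (x * (1 - x)))%C.
      -- rewrite RtoC_mult, !RtoC_pow, RtoC_minus, !Cpow_mult_l, Cpow_add_r, Cpow_mult_r.
         change ((z ^ 2 - 1) ^ 1)%C with ((z ^ 2 - 1) * 1)%C.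
         assert (((z ^ 2 - 1) ^ 2) ^ m <> 0)%C by now apply Cpow_nz, Cpow_nz.
         field. repeat split; assumption.
      -- unfold W. replace (Csqrt (v x) ^ 2)%C with (v x) by (rewrite <- (Csqrt_sq (v x)) at 1; ring).
         unfold v. ring.
  + destruct (ex_Cderive_inv _ _ _ Hn Hux) as [l Hl].
    unfold Cdiv. eapply is_Cderive_continuous, is_Cderive_mult; [|exact Hl].
    apply is_Cderive_RtoC.
    assert (He : ex_derive (fun x => x ^ m * (1 - x) ^ m) x) by (auto_derive; auto).
    apply Derive_correct, He.
- rewrite <- EQ. unfold I_rat.
  replace (z ^ 2 - 1)%C with ((z - 1) * (z + 1))%C by ring. rewrite Cpow_mult_l.
  field. split; now apply Cpow_nz.
Qed.

(** [epsilon] satisfies its predicate once some function does; the closed form [I_rat m] is such a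
    witness. *)
Lemma I_is_continuation m : is_continuation_of_I m (I_ m).
Proof.
unfold I_. apply epsilon_spec. exists (I_rat m). split.
- intros z Hz. apply strongly_analytic_analytic, I_rat_strongly_analytic.
  intros E. apply Hz. assert (E' : z = RtoC (-1)) by (replace z with (z + 1 - 1)%C by ring; rewrite E; ring).
  rewrite E'. simpl. lra.
- intros z Hz. symmetry. now apply I_integral_I_rat.
Qed.

(** Whatever continuation was chosen, it agrees with the closed form near 1, and agreement
    propagates along the segment from 1 to w, which stays in the slit plane. *)
Lemma I_eq_I_rat m w : slit_plane w -> I_ m w = I_rat m w.
Proof.
intros Hw. destruct (I_is_continuation m) as [Ha Hi].
assert (Hseg : forall t : R, 0 <= t <= 1 -> slit_plane (1 + t * (w - 1))%C).
{ intros t Ht [H1 H2]. apply Hw. destruct w as [a b]. simpl in *.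
  assert (t <> 0) by (intros ->; lra). split; nra. }
pose proof (Rabs_pos (Re w - 1)) as Hp.
(* For t below this bound, t |Re w - 1| < 1, so the point is still in the right half-plane, where
   both functions equal the integral. *)
apply (analytic_eq_segment (I_ m) (I_rat m) 1 w (/ (1 + Rabs (Re w - 1)))).
- apply Rinv_0_lt_compat. lra.
- intros t Ht. now apply Ha, Hseg.
- intros t Ht. apply strongly_analytic_analytic, I_rat_strongly_analytic.
  intros E. apply (Hseg t Ht).
  set (y := (1 + t * (w - 1))%C) in *.
  assert (E' : y = RtoC (-1)) by (replace y with (y + 1 - 1)%C by ring; rewrite E; ring).
  rewrite E'. simpl. lra.
- intros t [Ht0 Ht].
  assert (Hre : 0 < Re (1 + t * (w - 1))%C).
  { destruct w as [a b]. simpl in *. pose proof (Rle_abs (- (a - 1))) as H1. rewrite Rabs_Ropp in H1.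
    apply (Rmult_lt_compat_r (1 + Rabs (a - 1))) in Ht; [|lra]. rewrite Rinv_l in Ht by lra.
    unfold Rminus in *. nra. }
  rewrite Hi by assumption. now apply I_integral_I_rat.
Qed.

(** * The quartic integrals *)

(** A convergent integral over [0, oo) carried by an explicit primitive: linear combinations and
    exact derivatives become operations on primitives, and the passage to [RInt_gen] is made once,
    at the end. *)
Definition improper_primitive (g : R -> R) (l : R) : Prop :=
  exists P : R -> R, (forall x, is_derive P x (g x)) /\ P 0 = 0 /\ is_lim P p_infty l.

Lemma improper_primitive_ext f g l :
  (forall x, f x = g x) -> improper_primitive f l -> improper_primitive g l.
Proof.
intros E (P & H & H0 & Hl). exists P. split; [|split; assumption].
intros x. rewrite <- E. apply H.
Qed.

Lemma improper_primitive_lin a b f g lf lg :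
  improper_primitive f lf -> improper_primitive g lg ->
  improper_primitive (fun x => a * f x + b * g x) (a * lf + b * lg).
Proof.
intros (P & HP & HP0 & HPl) (T & HT & HT0 & HTl).
exists (fun x => a * P x + b * T x). split; [|split].
- intros x. apply (is_derive_plus (K := R_AbsRing) (V := R_NormedModule) (fun x => a * P x) (fun x => b * T x)).
  + now apply is_derive_scal.
  + now apply is_derive_scal.
- rewrite HP0, HT0. ring.
- apply (is_lim_plus' (fun x => a * P x) (fun x => b * T x)).
  + exact (is_lim_scal_l P a p_infty lf HPl).
  + exact (is_lim_scal_l T b p_infty lg HTl).
Qed.

Lemma improper_primitive_RInt_gen g l :
  (forall x, continuous g x) -> improper_primitive g l ->
  is_RInt_gen g (at_point 0) (Rbar_locally p_infty) l.
Proof.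
intros Hc (P & HP & HP0 & HPl).
assert (HD : forall x, Derive P x = g x) by (intros x; apply is_derive_unique, HP).
replace l with (l - 0) by ring.
eapply is_RInt_gen_ext with (f := Derive P).
- apply filter_forall. intros [a b] x _. apply HD.
- apply is_RInt_gen_Derive.
  + apply filter_forall. intros ab x _. eexists. apply HP.
  + apply filter_forall. intros ab x _. apply continuous_ext with (2 := Hc x).
    intros y. now rewrite HD.
  + intros Q HQ. unfold filtermap, at_point. rewrite HP0. now apply locally_singleton.
  + exact HPl.
Qed.

Lemma is_lim_of_bound (P : R -> R) (l K : R) :
  (forall x, 2 <= x -> Rabs (P x - l) <= K / x) -> is_lim P p_infty l.
Proof.
intros H. apply is_lim_spec. intros eps. simpl.
exists (Rmax 2 (K / eps)). intros x Hx.
assert (H2 := Rle_lt_trans _ _ _ (Rmax_l _ _) Hx).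
assert (HK := Rle_lt_trans _ _ _ (Rmax_r _ _) Hx).
pose proof (cond_pos eps) as He.
eapply Rle_lt_trans; [apply H; lra|].
apply Rmult_lt_reg_r with x; [lra|]. unfold Rdiv in *. rewrite Rmult_assoc, Rinv_l, Rmult_1_r by lra.
apply (Rmult_lt_compat_l eps) in HK; [|assumption].
replace (eps * (K * / eps)) with K in HK by (field; lra). lra.
Qed.

Lemma is_lim_atan_p_infty : is_lim atan p_infty (PI / 2).
Proof.
apply is_lim_ext_loc with (fun x => PI / 2 - atan (/ x)).
- exists 0. intros x Hx. rewrite atan_inv by assumption. ring.
- replace (Finite (PI / 2)) with (Finite (PI / 2 - atan 0)) by (rewrite atan_0; f_equal; ring).
  apply is_lim_minus'; [apply is_lim_const|].
  apply (is_lim_comp_continuous (fun x => / x) atan p_infty 0).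
  + apply (is_lim_inv (fun x => x) p_infty p_infty); [apply is_lim_id|discriminate].
  + apply (ex_derive_continuous (K := R_AbsRing) (V := R_NormedModule)). eexists. apply is_derive_atan.
Qed.

Lemma is_lim_atan_affine (c s : R) :
  0 < c -> is_lim (fun x => atan ((x + s) / c)) p_infty (PI / 2).
Proof.
intros Hc. apply (is_lim_comp atan (fun x => (x + s) / c) p_infty (PI / 2) p_infty).
- apply is_lim_atan_p_infty.
- apply is_lim_spec. intros M. exists (M * c - s). intros x Hx.
  apply Rmult_lt_reg_r with c; [assumption|]. unfold Rdiv. rewrite Rmult_assoc, Rinv_l by lra. lra.
- exists 0. intros x _. discriminate.
Qed.

Lemma ln_le_minus_1 (y : R) : 0 < y -> ln y <= y - 1.
Proof.
intros Hy. rewrite <- (ln_exp (y - 1)). apply ln_le; [assumption|].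
pose proof (exp_ineq1_le (y - 1)). lra.
Qed.

(** Both signs come from ln (u / v) <= u / v - 1, with (u, v) taken as (p, q) and as (q, p). *)
Lemma ln_minus_bound (p q d : R) : 0 < p -> 0 < q ->
  Rabs (p - q) <= d -> Rabs (ln p - ln q) <= d / Rmin p q.
Proof.
intros Hp Hq Hd.
assert (Hm : 0 < Rmin p q) by now apply Rmin_glb_lt.
assert (Hd0 := Rle_trans _ _ _ (Rabs_pos _) Hd).
assert (H : forall u v, 0 < u -> 0 < v -> u - v <= d -> Rmin p q <= v -> ln u - ln v <= d / Rmin p q).
{ intros u v Hu Hv Huv Hmv. rewrite <- ln_div by assumption.
  eapply Rle_trans; [apply ln_le_minus_1, Rdiv_lt_0_compat; assumption|].
  replace (u / v - 1) with ((u - v) / v) by (field; lra).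
  apply Rle_trans with (d / v).
  - apply Rmult_le_compat_r; [now apply Rlt_le, Rinv_0_lt_compat|assumption].
  - apply Rmult_le_compat_l; [assumption|]. now apply Rinv_le_contravar. }
apply Rabs_le_between in Hd. apply Rabs_le. split.
- assert (Hqp := H q p Hq Hp ltac:(lra) (Rmin_l _ _)). lra.
- apply H; try assumption; [lra|apply Rmin_r].
Qed.

Section Quartic.
Variables (c s a : R).
Hypothesis (Hc : 0 < c) (Hcs : s * s = 1 - c * c) (Ha : a = 2 * c * c - 1).

(** The intended values are c = cos (theta / 2), s = sin (theta / 2), a = cos theta; the roots of D
    are then the four numbers +-s +- i c. The case c = 1, s = 0 is a = 1. *)
Let D (x : R) : R := x ^ 4 + 2 * a * x ^ 2 + 1.

(** The difference of the two sides is s^2 (x^2 - 1)^2, since a = c^2 - s^2. *)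
Lemma quartic_lower_bound x : c ^ 2 * (x ^ 2 + 1) ^ 2 <= D x.
Proof.
assert (H : 0 <= s * s * ((x ^ 2 - 1) * (x ^ 2 - 1))) by (apply Rmult_le_pos; apply Rle_0_sqr).
unfold D. rewrite Ha. rewrite Hcs in H. lra.
Qed.

Lemma quartic_pos x : 0 < D x.
Proof.
eapply Rlt_le_trans; [|apply quartic_lower_bound].
apply Rmult_lt_0_compat; [|apply pow_lt]; nra.
Qed.

Lemma shifted_square_pos x t : 0 < (x + t) ^ 2 + c ^ 2.
Proof. pose proof (pow2_ge_0 (x + t)). pose proof (pow_lt c 2 Hc). lra. Qed.

Lemma quartic_factor x :
  D x = ((x + s) ^ 2 + c ^ 2) * ((x - s) ^ 2 + c ^ 2).
Proof.
unfold D. rewrite Ha.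
assert (Hs2 : s ^ 2 = 1 - c * c) by lra.
replace (((x + s) ^ 2 + c ^ 2) * ((x - s) ^ 2 + c ^ 2))
  with ((x ^ 2 - s ^ 2) ^ 2 + 2 * c ^ 2 * (x ^ 2 + s ^ 2) + c ^ 4) by ring.
rewrite Hs2. ring.
Qed.

(** The two quadratic factors of D add up to 2 (1 + x^2), so the integrand is half the sum of their
    inverses, each of which integrates to an arctangent. *)
Lemma quartic_base_plus : improper_primitive (fun x => (1 + x ^ 2) / D x) (PI / (2 * c)).
Proof.
exists (fun x => / (2 * c) * (atan ((x + s) / c) + atan ((x - s) / c))). split; [|split].
- intros x.
  pose proof (shifted_square_pos x s) as H1. pose proof (shifted_square_pos x (- s)) as H2.
  change (x + - s) with (x - s) in H2.
  rewrite quartic_factor.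
  assert (HA : forall t, is_derive (fun x => atan ((x + t) / c)) x (c / ((x + t) ^ 2 + c ^ 2))).
  { intros t.
    pose proof (shifted_square_pos x t) as Ht.
    replace (c / ((x + t) ^ 2 + c ^ 2)) with (scal (V := R_NormedModule) (/ c) (/ (1 + Rsqr ((x + t) / c)))).
    - apply (is_derive_comp (K := R_AbsRing) (V := R_NormedModule) atan (fun x => (x + t) / c)); [apply is_derive_atan|].
      auto_derive; [lra|]. field. lra.
    - unfold scal; simpl; unfold mult; simpl. unfold Rsqr. field. repeat split; try lra. }
  replace ((1 + x ^ 2) / (((x + s) ^ 2 + c ^ 2) * ((x - s) ^ 2 + c ^ 2)))
    with (/ (2 * c) * (c / ((x + s) ^ 2 + c ^ 2) + c / ((x + - s) ^ 2 + c ^ 2))).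
  + apply is_derive_scal.
    apply (is_derive_plus (K := R_AbsRing) (V := R_NormedModule) (fun x => atan ((x + s) / c)) (fun x => atan ((x + - s) / c)));
      apply HA.
  + change (x + - s) with (x - s). field_simplify_eq; [|repeat split; lra].
    assert (E : s ^ 2 = 1 - c ^ 2) by (simpl; lra).
    rewrite E. match goal with |- ?l = ?r => change (@eq R l r) end. ring.
- rewrite Rplus_0_l. replace ((0 - s) / c) with (- (s / c)) by (field; lra). rewrite atan_opp. ring.
- replace (PI / (2 * c)) with (/ (2 * c) * (PI / 2 + PI / 2)) by (field; lra).
  apply (is_lim_scal_l (fun x => atan ((x + s) / c) + atan ((x - s) / c)) (/ (2 * c)) p_infty (PI / 2 + PI / 2)).
  apply is_lim_plus'.
  + now apply is_lim_atan_affine.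
  + now apply (is_lim_atan_affine c (- s)).
Qed.

(** Here the primitive is the logarithm of the ratio of the two factors, divided by 4 s, hence s <>
    0. The ratio is 1 at 0 and tends to 1; equivalently x -> 1 / x changes the sign of the
    integral. *)
Lemma quartic_base_minus : s <> 0 -> improper_primitive (fun x => (1 - x ^ 2) / D x) 0.
Proof.
intros Hs.
pose proof shifted_square_pos as Hpos.
exists (fun x => / (4 * s) * (ln ((x + s) ^ 2 + c ^ 2) - ln ((x - s) ^ 2 + c ^ 2))). split; [|split].
- intros x. pose proof (Hpos x s) as H1. pose proof (Hpos x (- s)) as H2. change (x + - s) with (x - s) in H2.
  rewrite quartic_factor. auto_derive.
  + split; [exact H1|]. split; [exact H2|auto].
  + field_simplify_eq; [|repeat split; lra].
    assert (E : c ^ 2 = 1 - s ^ 2) by (simpl; lra).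
    match goal with |- ?l = ?r => change (@eq R l r) end.
    replace (c ^ 4) with ((c ^ 2) ^ 2) by ring. replace (c ^ 6) with ((c ^ 2) ^ 3) by ring.
    rewrite E. ring.
- rewrite Rplus_0_l. replace ((0 - s) ^ 2) with (s ^ 2) by ring. ring.
- replace (Finite 0) with (Rbar_mult (/ (4 * s)) 0) by (simpl; f_equal; ring).
  apply (is_lim_scal_l (fun x => ln ((x + s) ^ 2 + c ^ 2) - ln ((x - s) ^ 2 + c ^ 2)) (/ (4 * s)) p_infty 0).
  (* The factors differ by 4 s x, at most 4 x in absolute value, and each is at least x^2 / 4 for x
     >= 2; the quotient is 16 / x. *)
  apply is_lim_of_bound with 16. intros x Hx. rewrite Rminus_0_r.
  assert (Hs1 : -1 <= s <= 1) by nra.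
  assert (Hsq : forall t, -1 <= t <= 1 -> x ^ 2 / 4 <= (x + t) ^ 2 + c ^ 2) by (intros; nra).
  eapply Rle_trans.
  + apply ln_minus_bound with (d := 4 * x); [apply Hpos|apply (Hpos x (- s))|].
    apply Rabs_le. nra.
  + replace (16 / x) with (4 * x / (x ^ 2 / 4)) by (field; lra).
    apply Rmult_le_compat_l; [lra|]. apply Rinv_le_contravar; [nra|].
    apply Rmin_glb; [now apply Hsq|]. apply (Hsq (- s)). lra.
Qed.

Lemma quartic_base : s <> 0 ->
  improper_primitive (fun x => / D x ^ 1) (PI / (4 * c)) /\
  improper_primitive (fun x => x ^ 2 / D x ^ 1) (PI / (4 * c)).
Proof.
intros Hs.
assert (HD : forall x, D x <> 0) by (intros x; apply Rgt_not_eq, quartic_pos).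
pose proof quartic_base_plus as Hp. pose proof (quartic_base_minus Hs) as Hm. split.
- replace (PI / (4 * c)) with (/ 2 * (PI / (2 * c)) + / 2 * 0) by (field; lra).
  eapply improper_primitive_ext; [|exact (improper_primitive_lin (/ 2) (/ 2) _ _ _ _ Hp Hm)].
  intros x. simpl. field. apply HD.
- replace (PI / (4 * c)) with (/ 2 * (PI / (2 * c)) + - / 2 * 0) by (field; lra).
  eapply improper_primitive_ext; [|exact (improper_primitive_lin (/ 2) (- / 2) _ _ _ _ Hp Hm)].
  intros x. simpl. field. apply HD.
Qed.

(** Since D x >= c^2 x^4, the worst term x^3 / D^(k+1) is O(1 / x). *)
Lemma quartic_boundary (al be : R) (k : nat) :
  is_lim (fun x => (al * x + be * x ^ 3) / D x ^ S k) p_infty 0.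
Proof.
apply is_lim_of_bound with ((Rabs al + Rabs be) * (/ c ^ 2) ^ S k). intros x Hx.
rewrite Rminus_0_r. unfold Rdiv. rewrite Rabs_mult.
assert (HDx := quartic_pos x).
rewrite (Rabs_pos_eq (/ D x ^ S k)) by (apply Rlt_le, Rinv_0_lt_compat, pow_lt; assumption).
assert (Hc2 : 0 < c ^ 2) by now apply pow_lt.
assert (H1 : / D x ^ S k <= (/ c ^ 2) ^ S k * / x ^ 4).
{ rewrite pow_inv, <- Rinv_mult. apply Rinv_le_contravar.
  - apply Rmult_lt_0_compat; [now apply pow_lt|apply pow_lt; lra].
  - apply Rle_trans with ((c ^ 2) ^ S k * (x ^ 4) ^ S k).
    + apply Rmult_le_compat_l; [now apply Rlt_le, pow_lt|].
      rewrite <- (pow_1 (x ^ 4)) at 1. apply Rle_pow; [|lia]. apply pow_R1_Rle. lra.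
    + rewrite <- Rpow_mult_distr. apply pow_incr. split.
      * apply Rmult_le_pos; [lra|]. apply pow_le. lra.
      * eapply Rle_trans; [|apply quartic_lower_bound]. apply Rmult_le_compat_l; [lra|].
        replace (x ^ 4) with ((x ^ 2) ^ 2) by ring. apply pow_incr. nra. }
assert (H2 : Rabs (al * x + be * x ^ 3) <= (Rabs al + Rabs be) * x ^ 3).
{ eapply Rle_trans; [apply Rabs_triang|]. rewrite !Rabs_mult, (Rabs_pos_eq x), (Rabs_pos_eq (x ^ 3)) by (try apply pow_le; lra).
  rewrite Rmult_plus_distr_r. apply Rplus_le_compat_r. apply Rmult_le_compat_l; [apply Rabs_pos|].
  simpl. nra. }
replace ((Rabs al + Rabs be) * (/ c ^ 2) ^ S k * / x)
  with ((Rabs al + Rabs be) * x ^ 3 * ((/ c ^ 2) ^ S k * / x ^ 4))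
  by (replace (/ x) with (x ^ 3 * / x ^ 4) by (field; lra); ring).
apply Rmult_le_compat; try assumption.
- apply Rabs_pos.
- apply Rlt_le, Rinv_0_lt_compat, pow_lt. assumption.
Qed.

(** The integrand is the derivative of (al x + be x^3) / D^(k+1), which vanishes at 0 and at
    infinity. The choices of (al, be) below produce the two recurrences. *)
Lemma quartic_exact (al be : R) (k : nat) :
  improper_primitive (fun x => (al + 3 * be * x ^ 2) / D x ^ S k
    - INR (S k) * (al * x + be * x ^ 3) * (4 * x ^ 3 + 4 * a * x) / D x ^ S (S k)) 0.
Proof.
exists (fun x => (al * x + be * x ^ 3) / D x ^ S k). split; [|split].
- intros x. assert (HDx := quartic_pos x).
  assert (Hp : 0 < D x ^ k) by now apply pow_lt.
  assert (HdD : is_derive D x (4 * x ^ 3 + 4 * a * x)) by (unfold D; auto_derive; [auto|ring]).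
  pose proof (is_derive_pow D (S k) x _ HdD) as H1.
  assert (H2 : is_derive (fun x => al * x + be * x ^ 3) x (al + 3 * be * x ^ 2)) by (auto_derive; [auto|ring]).
  pose proof (is_derive_div (fun x => al * x + be * x ^ 3) (fun x => D x ^ S k) x _ _ H2 H1) as H3.
  assert (Hn : D x ^ S k <> 0) by (apply Rgt_not_eq, pow_lt; assumption).
  specialize (H3 Hn). clear H1 H2.
  match type of H3 with is_derive _ _ ?v => match goal with |- is_derive _ _ ?w =>
    replace w with v; [exact H3|] end end.
  change (Nat.pred (S k)) with k. simpl pow. field. split; lra.
- unfold Rdiv. rewrite Rmult_0_r, pow_i by lia. rewrite Rmult_0_r. ring.
- apply quartic_boundary.
Qed.

(** Take (al, be) = (a, 1): then (a x + x^3) D' = 4 x^2 (x^2 + a)^2 and (x^2 + a)^2 = D - (1 - a^2),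
    so the only integral with the higher power of D is that of x^2, with coefficient proportional to
    1 - a^2. *)
Lemma quartic_rec_x2 (k : nat) (A B : R) : a ^ 2 <> 1 ->
  improper_primitive (fun x => / D x ^ S k) A ->
  improper_primitive (fun x => x ^ 2 / D x ^ S k) B ->
  improper_primitive (fun x => x ^ 2 / D x ^ S (S k))
    (((4 * INR (S k) - 3) * B - a * A) / (4 * INR (S k) * (1 - a ^ 2))).
Proof.
intros Ha2 HA HB.
assert (HK : INR (S k) <> 0) by (apply not_0_INR; lia).
set (K := INR (S k)) in *.
assert (Hn : 1 - a ^ 2 <> 0) by lra.
pose proof (improper_primitive_lin (- a / (4 * K * (1 - a ^ 2))) ((4 * K - 3) / (4 * K * (1 - a ^ 2))) _ _ _ _ HA HB) as H1.
pose proof (improper_primitive_lin 1 (/ (4 * K * (1 - a ^ 2))) _ _ _ _ H1 (quartic_exact a 1 k)) as H2.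
match type of H2 with improper_primitive _ ?v => replace v with
  (((4 * K - 3) * B - a * A) / (4 * K * (1 - a ^ 2))) in H2 by (field; auto) end.
revert H2. apply improper_primitive_ext. intros x. fold K.
assert (HDx := quartic_pos x).
assert (Hp : 0 < D x ^ k) by now apply pow_lt.
replace (4 * x ^ 3 + 4 * a * x) with (4 * x * (x ^ 2 + a)) by ring.
assert (E : x ^ 4 = D x - 2 * a * x ^ 2 - 1) by (unfold D; ring).
replace (K * (a * x + 1 * x ^ 3) * (4 * x * (x ^ 2 + a)))
  with (4 * K * (x ^ 2 * x ^ 4 + 2 * a * x ^ 4 + a ^ 2 * x ^ 2)) by ring.
replace (x ^ 2 * x ^ 4 + 2 * a * x ^ 4 + a ^ 2 * x ^ 2)
  with ((x ^ 2) * (D x) - (1 - a ^ 2) * x ^ 2) by (unfold D; ring).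
simpl (D x ^ S (S k)). simpl (D x ^ S k). field. repeat split; try assumption; lra.
Qed.

(** Take (al, be) = (1, 0): x D' = 4 (D - a x^2 - 1). *)
Lemma quartic_rec_1 (k : nat) (A B : R) :
  improper_primitive (fun x => / D x ^ S k) A ->
  improper_primitive (fun x => x ^ 2 / D x ^ S (S k)) B ->
  improper_primitive (fun x => / D x ^ S (S k))
    ((4 * INR (S k) - 1) / (4 * INR (S k)) * A - a * B).
Proof.
intros HA HB.
assert (HK : INR (S k) <> 0) by (apply not_0_INR; lia).
set (K := INR (S k)) in *.
pose proof (improper_primitive_lin ((4 * K - 1) / (4 * K)) (- a) _ _ _ _ HA HB) as H1.
pose proof (improper_primitive_lin 1 (/ (4 * K)) _ _ _ _ H1 (quartic_exact 1 0 k)) as H2.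
match type of H2 with improper_primitive _ ?v => replace v with
  ((4 * K - 1) / (4 * K) * A - a * B) in H2 by (field; auto) end.
revert H2. apply improper_primitive_ext. intros x. fold K.
assert (HDx := quartic_pos x).
assert (Hp : 0 < D x ^ k) by now apply pow_lt.
replace (K * (1 * x + 0 * x ^ 3) * (4 * x ^ 3 + 4 * a * x))
  with (4 * K * (D x - a * x ^ 2 - 1)) by (unfold D; ring).
simpl (D x ^ S (S k)). simpl (D x ^ S k). field. repeat split; try assumption; lra.
Qed.

Lemma N04_of_primitive (m : nat) (l : R) :
  improper_primitive (fun x => / D x ^ S m) l -> N04 a m = l.
Proof.
intros H. unfold N04. rewrite Nat.add_1_r. apply is_RInt_gen_unique.
apply improper_primitive_RInt_gen; [|exact H]. intros x.
apply (ex_derive_continuous (K := R_AbsRing) (V := R_NormedModule)).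
assert (HDx := quartic_pos x).
assert (Hp : D x ^ S m <> 0) by (apply Rgt_not_eq, pow_lt; assumption).
unfold D in *. auto_derive. exact Hp.
Qed.

End Quartic.

(** * Beta integrals *)

(** All conditions stay inside ]0, 1[: at either endpoint one of the powers in [Beta] has base 0,
    where [Rpower] has only a conventional value. The primitive enters through its one-sided
    limits. *)
Lemma is_RInt_gen_open_01 (G g : R -> R) (l0 l1 : R) :
  (forall x, 0 < x < 1 -> is_derive G x (g x)) ->
  (forall x, 0 < x < 1 -> continuous g x) ->
  filterlim G (at_right 0) (locally l0) -> filterlim G (at_left 1) (locally l1) ->
  is_RInt_gen g (at_right 0) (at_left 1) (l1 - l0).
Proof.
intros HG Hg H0 H1.
assert (HD : forall x, 0 < x < 1 -> Derive G x = g x) by (intros x Hx; now apply is_derive_unique, HG).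
assert (HF : filter_prod (at_right 0) (at_left 1) (fun ab : R * R => 0 < fst ab < 1 /\ 0 < snd ab < 1)).
{ assert (Hhalf : 0 < / 2) by lra.
  apply Filter_prod with (fun x => 0 < x < 1) (fun x => 0 < x < 1).
  - exists (mkposreal _ Hhalf). intros y Hy Hy0. apply Rabs_lt_between in Hy.
    unfold minus, plus, opp in Hy; simpl in Hy. lra.
  - exists (mkposreal _ Hhalf). intros y Hy Hy0. apply Rabs_lt_between in Hy.
    unfold minus, plus, opp in Hy; simpl in Hy. lra.
  - intros x y Hx Hy. now split. }
assert (Hin : forall a b x : R, 0 < a < 1 -> 0 < b < 1 -> Rmin a b <= x <= Rmax a b -> 0 < x < 1).
{ intros a b x Ha Hb [H2 H3]. split.
  - apply Rlt_le_trans with (2 := H2). apply Rmin_glb_lt; lra.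
  - apply Rle_lt_trans with (1 := H3). apply Rmax_lub_lt; lra. }
apply is_RInt_gen_ext with (f := Derive G).
- revert HF. apply filter_imp. intros [a b] [Ha Hb] x Hx. apply HD. apply (Hin a b x Ha Hb). simpl in Hx. lra.
- apply is_RInt_gen_Derive; try assumption.
  + revert HF. apply filter_imp. intros [a b] [Ha Hb] x Hx. eexists. apply HG. now apply (Hin a b).
  + revert HF. apply filter_imp. intros [a b] [Ha Hb] x Hx.
    pose proof (Hin a b x Ha Hb Hx) as Hx01.
    apply continuous_ext_loc with g; [|now apply Hg].
    assert (Hl : locally x (fun y => 0 < y /\ y < 1)).
    { apply filter_and; [now apply open_gt|now apply open_lt]. }
    revert Hl. apply filter_imp. intros y Hy. symmetry. now apply HD.
Qed.

Lemma Beta_at_nat (m : nat) (l : R) :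
  is_RInt (fun x => x ^ m * (1 - x) ^ m) 0 1 l -> Beta (INR m + 1) (INR m + 1) = l.
Proof.
intros Hl. unfold Beta. apply is_RInt_gen_unique.
set (g := fun x => x ^ m * (1 - x) ^ m) in *.
assert (Hg : forall x, continuous g x).
{ intros x. apply (ex_derive_continuous (K := R_AbsRing) (V := R_NormedModule)).
  unfold g. auto_derive. auto. }
assert (Hex : forall u v, ex_RInt g u v) by (intros u v; apply (ex_RInt_continuous (V := R_CompleteNormedModule)); intros; apply Hg).
assert (HG : forall x, is_derive (fun y => RInt g 0 y) x (g x)).
{ intros x. apply (is_derive_RInt g (fun y => RInt g 0 y) 0 x).
  - apply filter_forall. intros y. apply (RInt_correct (V := R_CompleteNormedModule)), Hex.
  - apply Hg. }
assert (HGc : forall x, continuous (fun y => RInt g 0 y) x).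
{ intros x. apply (ex_derive_continuous (K := R_AbsRing) (V := R_NormedModule)). eexists. apply HG. }
assert (HRp : forall x, 0 < x -> Rpower x (INR m + 1 - 1) = x ^ m).
{ intros x Hx. rewrite <- Rpower_pow by assumption. f_equal. ring. }
assert (E : forall x, 0 < x < 1 -> g x = Rpower x (INR m + 1 - 1) * Rpower (1 - x) (INR m + 1 - 1)).
{ intros x Hx. unfold g. rewrite !HRp by lra. reflexivity. }
assert (E1 : RInt g 0 1 = l) by (now apply is_RInt_unique).
assert (E0 : RInt g 0 0 = 0) by exact (RInt_point (V := R_CompleteNormedModule) 0 g).
replace l with (RInt g 0 1 - RInt g 0 0) by (rewrite E0, E1; ring).
apply (is_RInt_gen_open_01 (fun y => RInt g 0 y)).
- intros x Hx. rewrite <- E by assumption. apply HG.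
- intros x Hx. apply continuous_ext_loc with g; [|apply Hg].
  assert (Hloc : locally x (fun y => 0 < y /\ y < 1)).
  { apply filter_and; [now apply open_gt|now apply open_lt]. }
  revert Hloc. apply filter_imp. intros y Hy. now apply E.
- intros P HP. apply filter_le_within. exact (HGc 0 P HP).
- intros P HP. apply filter_le_within. exact (HGc 1 P HP).
Qed.

(** This is B(m+1, m+1) = m!^2 / (2m+1)!, given by its ratio m^2 / (2m (2m+1)). *)
Fixpoint beta_nat (m : nat) : R :=
  match m with
  | 0%nat => 1
  | S j => INR (S j) / (4 * INR (S j) + 2) * beta_nat j
  end.

Lemma beta_nat_pos m : 0 < beta_nat m.
Proof.
induction m as [|m IH]; cbn [beta_nat]; [lra|].
assert (HK : 0 < INR (S m)) by apply lt_0_INR, Nat.lt_0_succ.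
apply Rmult_lt_0_compat; [apply Rdiv_lt_0_compat; lra|assumption].
Qed.

Lemma is_RInt_beta_nat (m : nat) : is_RInt (fun x => x ^ m * (1 - x) ^ m) 0 1 (beta_nat m).
Proof.
induction m as [|j IH].
- pose proof (is_RInt_const (V := R_NormedModule) 0 1 1) as H.
  replace (beta_nat 0) with (scal (V := R_NormedModule) (1 - 0) 1) by (unfold scal; simpl; unfold mult; simpl; ring).
  eapply is_RInt_ext; [|exact H]. intros x _. simpl. ring.
- assert (HK : 0 < INR (S j)) by apply lt_0_INR, Nat.lt_0_succ.
  set (K := INR (S j)) in *.
  (* With y = x (1 - x) and (2 x - 1)^2 = 1 - 4 y, this is the derivative of y^(j+1) (2 x - 1),
     which vanishes at both ends. *)
  set (df := fun x => - K * (x * (1 - x)) ^ j + (4 * K + 2) * (x * (1 - x)) ^ S j).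
  assert (HD : exists l, l = 0 /\ is_RInt df 0 1 l).
  { pose proof (is_RInt_derive (V := R_CompleteNormedModule) (fun x => (x * (1 - x)) ^ S j * (2 * x - 1)) df 0 1) as D.
    eexists. split; [|apply D].
    - unfold minus, plus, opp; simpl. ring.
    - intros x _.
        assert (H1 : is_derive (fun x => x * (1 - x)) x (1 - 2 * x)) by (auto_derive; [auto|ring]).
        assert (H2 : is_derive (fun x => 2 * x - 1) x 2) by (auto_derive; [auto|ring]).
        pose proof (is_derive_mult (K := R_AbsRing) _ _ _ _ _ (is_derive_pow _ (S j) _ _ H1) H2 Rmult_comm) as H3.
        match type of H3 with is_derive _ _ ?v => replace (df x) with v; [exact H3|] end.
        unfold df. change (Nat.pred (S j)) with j. fold K. unfold plus, mult; simpl. fold K. ring.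
    - intros x _. apply (ex_derive_continuous (K := R_AbsRing) (V := R_NormedModule)).
      unfold df. auto_derive. auto. }
  destruct HD as (l & -> & HD).
  pose proof (is_RInt_plus (V := R_NormedModule) _ _ _ _ _ _
    (is_RInt_scal (V := R_NormedModule) _ _ _ (/ (4 * K + 2)) _ HD)
    (is_RInt_scal (V := R_NormedModule) _ _ _ (K / (4 * K + 2)) _ IH)) as H.
  match type of H with is_RInt _ _ _ ?v => replace v with (beta_nat (S j)) in H end.
  + eapply is_RInt_ext; [|exact H]. intros x _. unfold df, plus, scal; simpl; unfold mult; simpl.
    change (x * x ^ j * ((1 - x) * (1 - x) ^ j)) with (x ^ S j * (1 - x) ^ S j).
    rewrite <- !Rpow_mult_distr. simpl pow. field. lra.
  + cbn [beta_nat]. fold K. unfold plus, scal; simpl; unfold mult; simpl. ring.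
Qed.

(** Wallis reduction: differentiate x / (1 + x^2)^K with K = p + 1 and replace x^2 by (1 + x^2) -
    1. *)
Lemma improper_primitive_inv_square_pow (p : nat) (l : R) :
  improper_primitive (fun x => / (1 + x ^ 2) ^ S p) l ->
  improper_primitive (fun x => / (1 + x ^ 2) ^ S (S p)) ((2 * INR (S p) - 1) / (2 * INR (S p)) * l).
Proof.
intros Hl.
assert (HK : 0 < INR (S p)) by apply lt_0_INR, Nat.lt_0_succ.
set (K := INR (S p)) in *.
assert (H : improper_primitive
  (fun x => (1 - 2 * K) / (1 + x ^ 2) ^ S p + 2 * K / (1 + x ^ 2) ^ S (S p)) 0).
{ exists (fun x => x / (1 + x ^ 2) ^ S p). split; [|split].
  - intros x. assert (Hx : 0 < 1 + x ^ 2) by (pose proof (pow2_ge_0 x); lra).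
    assert (Hp : 0 < (1 + x ^ 2) ^ p) by now apply pow_lt.
    assert (Hn : (1 + x ^ 2) ^ S p <> 0) by (apply Rgt_not_eq, pow_lt; assumption).
    assert (H1 : is_derive (fun x => 1 + x ^ 2) x (2 * x)) by (auto_derive; [auto|ring]).
    assert (H2 : is_derive (fun x : R => x) x 1) by exact (is_derive_id (K := R_AbsRing) x).
    pose proof (is_derive_div _ _ _ _ _ H2 (is_derive_pow _ (S p) _ _ H1) Hn) as H3.
    match type of H3 with is_derive _ _ ?v => match goal with |- is_derive _ _ ?w =>
      replace w with v; [exact H3|] end end.
    change (Nat.pred (S p)) with p. fold K.
    match goal with |- ?l = ?r => change (@eq R l r) end.
    change ((1 + x ^ 2) ^ S (S p)) with ((1 + x ^ 2) * ((1 + x ^ 2) * (1 + x ^ 2) ^ p)).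
    change ((1 + x ^ 2) ^ S p) with ((1 + x ^ 2) * (1 + x ^ 2) ^ p).
    field. split; lra.
  - unfold Rdiv. ring.
  - apply is_lim_of_bound with 1. intros x Hx. rewrite Rminus_0_r.
    assert (H1 : 1 + x ^ 2 <= (1 + x ^ 2) ^ S p).
    { rewrite <- (pow_1 (1 + x ^ 2)) at 1. apply Rle_pow; [nra|lia]. }
    rewrite Rabs_pos_eq.
    + replace (1 / x) with (x / x ^ 2) by (field; lra).
      apply Rmult_le_compat_l; [lra|]. apply Rinv_le_contravar; nra.
    + apply Rdiv_le_0_compat; nra. }
pose proof (improper_primitive_lin (/ (2 * K)) ((2 * K - 1) / (2 * K)) _ _ _ _ H Hl) as H1.
replace ((2 * K - 1) / (2 * K) * l) with (/ (2 * K) * 0 + (2 * K - 1) / (2 * K) * l) by ring.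
revert H1. apply improper_primitive_ext. intros x.
assert (Hx : 0 < 1 + x ^ 2) by (pose proof (pow2_ge_0 x); lra).
assert (Hp : 0 < (1 + x ^ 2) ^ p) by now apply pow_lt.
change ((1 + x ^ 2) ^ S (S p)) with ((1 + x ^ 2) * ((1 + x ^ 2) * (1 + x ^ 2) ^ p)).
change ((1 + x ^ 2) ^ S p) with ((1 + x ^ 2) * (1 + x ^ 2) ^ p).
field. repeat split; lra.
Qed.

(** The integral of (1 + x^2)^(-2m-2), that is N_m at a = 1. Its ratio combines two Wallis factors,
    (4K - 1) / (4K) and (4K + 1) / (4K + 2). *)
Fixpoint tau (m : nat) : R :=
  match m with
  | 0%nat => PI / 4
  | S j => (4 * INR (S j) + 1) * (4 * INR (S j) - 1)
           / ((4 * INR (S j) + 2) * (4 * INR (S j))) * tau j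
  end.

Lemma improper_primitive_tau (m : nat) :
  improper_primitive (fun x => / (1 + x ^ 2) ^ (2 * m + 2)) (tau m).
Proof.
induction m as [|j IH].
- replace (tau 0) with ((2 * INR 1 - 1) / (2 * INR 1) * (PI / 2)) by (simpl; field).
  change (2 * 0 + 2)%nat with 2%nat. apply improper_primitive_inv_square_pow.
  exists atan. split; [|split].
  + intros x. rewrite pow_1. replace (x ^ 2) with (Rsqr x) by (unfold Rsqr; ring). apply is_derive_atan.
  + apply atan_0.
  + apply is_lim_atan_p_infty.
- replace (2 * S j + 2)%nat with (S (S (S (2 * j + 1))))%nat by lia.
  replace (2 * j + 2)%nat with (S (2 * j + 1))%nat in IH by lia.
  pose proof (improper_primitive_inv_square_pow _ _ (improper_primitive_inv_square_pow _ _ IH)) as H.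
  match type of H with improper_primitive _ ?v => replace (tau (S j)) with v; [exact H|] end.
  assert (HK : 0 < INR (S j)) by apply lt_0_INR, Nat.lt_0_succ.
  cbn [tau].
  replace (INR (S (S (2 * j + 1)))) with (2 * INR (S j) + 1)
    by (rewrite !S_INR, plus_INR, mult_INR; simpl; ring).
  replace (INR (S (2 * j + 1))) with (2 * INR (S j))
    by (rewrite !S_INR, plus_INR, mult_INR; simpl; ring).
  field. repeat split; lra.
Qed.

(* Substitution x = y^2 / (1 + y^2). *)
Lemma Beta_half (m : nat) : Beta (1 / 2) (2 * INR m + 3 / 2) = 2 * tau m.
Proof.
destruct (improper_primitive_tau m) as (P & HP & HP0 & HPl).
unfold Beta. apply is_RInt_gen_unique.
replace (2 * tau m) with (2 * tau m - 2 * P 0) by (rewrite HP0; ring).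
set (psi := fun x => sqrt (x / (1 - x))).
assert (HPc : forall x, continuous P x).
{ intros x. apply (ex_derive_continuous (K := R_AbsRing) (V := R_NormedModule)). eexists. apply HP. }
apply (is_RInt_gen_open_01 (fun x => 2 * P (psi x))).
- intros x Hx.
  assert (Hq : 0 < x / (1 - x)) by (apply Rdiv_lt_0_compat; lra).
  assert (Hsq : psi x * psi x = x / (1 - x)) by (apply sqrt_sqrt; lra).
  assert (Hpsi : 0 < psi x) by now apply sqrt_lt_R0.
  assert (Hd : is_derive psi x (/ (2 * psi x * (1 - x) ^ 2))).
  { unfold psi. auto_derive; [split; [lra|split; [assumption|auto]]|].
    change (sqrt (x * / (1 + - x))) with (psi x). change (sqrt (x / (1 - x))) with (psi x).
    field. split; lra. }
  pose proof (is_derive_comp (K := R_AbsRing) (V := R_NormedModule) P psi x _ _ (HP (psi x)) Hd) as H1.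
  pose proof (is_derive_scal (fun x => P (psi x)) x 2 _ H1) as H2.
  match type of H2 with is_derive _ _ ?v => match goal with |- is_derive _ _ ?w =>
    replace w with v; [exact H2|] end end.
  unfold scal; simpl; unfold mult; simpl.
  replace (1 + psi x * (psi x * 1)) with (/ (1 - x)) by (rewrite Rmult_1_r, Hsq; field; lra).
  rewrite pow_inv, Rinv_inv.
  assert (Hr1 : Rpower x (1 / 2 - 1) = / sqrt x).
  { replace (1 / 2 - 1) with (- / 2) by lra. rewrite Rpower_Ropp, Rpower_sqrt by lra. reflexivity. }
  assert (Hr2 : Rpower (1 - x) (2 * INR m + 3 / 2 - 1) = (1 - x) ^ (2 * m) * sqrt (1 - x)).
  { replace (2 * INR m + 3 / 2 - 1) with (INR (2 * m) + / 2) by (rewrite mult_INR; simpl; lra).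
    rewrite Rpower_plus, Rpower_pow, Rpower_sqrt by lra. reflexivity. }
  rewrite Hr1, Hr2.
  assert (Hpe : psi x = sqrt x / sqrt (1 - x)) by (unfold psi; apply sqrt_div_alt; lra).
  assert (0 < sqrt x) by (apply sqrt_lt_R0; lra).
  assert (0 < sqrt (1 - x)) by (apply sqrt_lt_R0; lra).
  rewrite Hpe. replace (m + (m + 0) + 2)%nat with (2 * m + 2)%nat by lia.
  rewrite pow_add. field. repeat split; lra.
- intros x Hx. apply (ex_derive_continuous (K := R_AbsRing) (V := R_NormedModule)).
  unfold Rpower. auto_derive. lra.
- replace 0 with (psi 0) at 2 by (unfold psi; rewrite Rdiv_0_l; apply sqrt_0).
  assert (Hc : continuous (fun x => 2 * P (psi x)) 0).
  { apply (continuous_mult (fun _ => 2) (fun x => P (psi x))); [apply continuous_const|].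
    apply (continuous_comp psi P); [|apply HPc].
    apply (continuous_comp (fun x => x / (1 - x)) sqrt).
    - apply (ex_derive_continuous (K := R_AbsRing) (V := R_NormedModule)). auto_derive. lra.
    - apply continuous_sqrt. }
  intros Q HQ. apply filter_le_within. exact (Hc Q HQ).
- assert (HL : is_lim (fun y => 2 * P y) p_infty (2 * tau m))
    by exact (is_lim_scal_l P 2 p_infty (tau m) HPl).
  apply (filterlim_comp _ _ _ psi (fun y => 2 * P y) (at_left 1) (Rbar_locally p_infty)); [|exact HL].
  intros Q [M HM].
  set (N := Rmax M 1). assert (HN1 : 1 <= N) by apply Rmax_r. assert (HNM : M <= N) by apply Rmax_l.
  assert (Hd : 0 < / (1 + N ^ 2)) by (apply Rinv_0_lt_compat; nra).
  exists (mkposreal _ Hd). intros x Hx Hx1. apply HM.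
  apply Rle_lt_trans with (1 := HNM).
  rewrite <- (sqrt_pow2 N) by lra. apply sqrt_lt_1_alt. split; [nra|].
  apply Rabs_lt_between in Hx. unfold minus, plus, opp in Hx; simpl in Hx.
  assert (H1x : 1 - x < / (1 + N ^ 2)) by (simpl; lra).
  apply (Rmult_lt_compat_r (1 + N ^ 2)) in H1x; [|nra]. rewrite Rinv_l in H1x by nra.
  apply Rmult_lt_reg_r with (1 - x); [lra|]. unfold Rdiv. rewrite Rmult_assoc, Rinv_l by lra. nra.
Qed.

(** * Recurrences for Q_m *)

Definition Csmooth (f : R -> C) : Prop := forall t, exists l : C, is_Cderive f t l.

Lemma Csmooth_mult f g : Csmooth f -> Csmooth g -> Csmooth (fun t => f t * g t)%C.
Proof.
intros Hf Hg t. destruct (Hf t) as [l Hl]. destruct (Hg t) as [l' Hl'].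
eexists. exact (is_Cderive_mult f g t l l' Hl Hl').
Qed.

Lemma Csmooth_plus f g : Csmooth f -> Csmooth g -> Csmooth (fun t => f t + g t)%C.
Proof.
intros Hf Hg t. destruct (Hf t) as [l Hl]. destruct (Hg t) as [l' Hl'].
eexists. exact (is_Cderive_plus f g t l l' Hl Hl').
Qed.

Lemma Csmooth_scal k f : Csmooth f -> Csmooth (fun t => k * f t)%C.
Proof. intros Hf t. destruct (Hf t) as [l Hl]. eexists. exact (is_Cderive_scal k f t l Hl). Qed.

Lemma Csmooth_pow f n : Csmooth f -> Csmooth (fun t => f t ^ n)%C.
Proof. intros Hf t. destruct (Hf t) as [l Hl]. exact (ex_Cderive_pow f t l n Hl). Qed.

Definition dqpoly (z : C) (t : R) : C :=
  ((((1 - t - t) * (2 + (z - 1) * t) + t * (1 - t) * (z - 1)) * (z + 1 + (z - 1) * t))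
   + t * (1 - t) * (2 + (z - 1) * t) * (z - 1))%C.

Lemma is_Cderive_qpoly z t : is_Cderive (qpoly z) t (dqpoly z t).
Proof.
assert (HA : forall k : C, is_Cderive (fun t => k + (z - 1) * t)%C t (z - 1)%C).
{ intros k.
  pose proof (is_Cderive_plus _ _ t _ _ (is_Cderive_const k t)
    (is_Cderive_scal (z - 1)%C _ t _ (is_Cderive_id t))) as H.
  replace (0 + (z - 1) * 1)%C with (z - 1)%C in H by ring. exact H. }
assert (H1 : is_Cderive (fun t => 1 - t)%C t (RtoC (-1))).
{ apply is_derive_ext with (f := fun t : R => (1 + RtoC (-1) * t)%C).
  - intros s. match goal with |- ?a = ?b => change (@eq C a b) end. ring.
  - pose proof (is_Cderive_plus _ _ t _ _ (is_Cderive_const 1 t)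
      (is_Cderive_scal (RtoC (-1)) _ t _ (is_Cderive_id t))) as H.
    replace (0 + RtoC (-1) * 1)%C with (RtoC (-1)) in H by ring. exact H. }
pose proof (is_Cderive_mult _ _ _ _ _ (is_Cderive_mult _ _ _ _ _
  (is_Cderive_mult _ _ _ _ _ (is_Cderive_id t) H1) (HA 2)) (HA (z + 1)%C)) as H.
match type of H with is_derive _ _ ?v => replace (dqpoly z t) with (v : C); [exact H|] end.
unfold dqpoly. ring.
Qed.

Lemma Csmooth_qpoly z : Csmooth (qpoly z).
Proof. intros t. eexists. apply is_Cderive_qpoly. Qed.

Lemma Csmooth_upath z : Csmooth (upath z).
Proof. intros t. eexists. apply is_Cderive_upath. Qed.

(** Counterpart of [quartic_exact]: the boundary terms vanish because [qpoly] contains t (1 - t).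
    The outer factor z - 1 clears denominators, as (z - 1) times the t-derivative of [qpoly] is the
    u-derivative of W. *)
Lemma qpoly_exact z k (al be : C) (l : C) (df : R -> C) :
  (forall t : R, df t = ((z - 1) * ((al + be * 3 * upath z t ^ 2) * (z - 1) * qpoly z t ^ S k
     + (al * upath z t + be * upath z t ^ 3) * (INR (S k) * qpoly z t ^ k * dqpoly z t)))%C) ->
  Csmooth df -> is_CRInt df 0 1 l -> l = 0.
Proof.
intros E Hs Hl. apply (is_CRInt_unique df 0 1); [exact Hl|].
set (G := fun t => ((z - 1) * ((al * upath z t + be * upath z t ^ 3) * qpoly z t ^ S k))%C).
replace (RtoC 0) with (G 1 - G 0)%C by (unfold G, qpoly; simpl Cpow; ring).
apply is_CRInt_derive.
- intros t _. rewrite E. unfold G. apply is_Cderive_scal.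
  replace ((al + be * 3 * upath z t ^ 2) * (z - 1))%C
    with (al * (z - 1) + be * (INR 3 * upath z t ^ 2 * (z - 1)))%C by (replace (INR 3) with 3 by (simpl; ring); ring).
  apply is_Cderive_mult.
  + apply is_Cderive_plus; apply is_Cderive_scal.
    * apply is_Cderive_upath.
    * exact (is_Cderive_pow (upath z) t _ 2 (is_Cderive_upath z t)).
  + exact (is_Cderive_pow (qpoly z) t _ k (is_Cderive_qpoly z t)).
- intros t _. destruct (Hs t) as [l' Hl']. exact (is_Cderive_continuous _ _ _ Hl').
Qed.

(** The case (al, be) = (1, 0), with u W' = 4 W - 2 (1 + z^2) u^2 + 4 z^2 and W = (z - 1)^2
    [qpoly]. *)
Lemma Q_rec (j : nat) (z : C) : let K := RtoC (INR (S j)) in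
  ((4 * K + 1) * (z - 1) ^ 2 * Q (S j) z
   = K * (2 * (1 + z ^ 2) * Q2 j z - 4 * z ^ 2 * Q j z))%C.
Proof.
intros K. apply Ceq_minus.
apply (qpoly_exact z j 1 0 _ (fun t => (4 * K + 1) * (z - 1) ^ 2 * qpoly z t ^ S j
  + ((- 2 * K * (1 + z ^ 2)) * (upath z t ^ 2 * qpoly z t ^ j) + 4 * K * z ^ 2 * qpoly z t ^ j))%C).
- intros t. fold K. simpl Cpow. unfold dqpoly, upath, qpoly.
  set (P := ((t * (1 - t) * (2 + (z - 1) * t) * (z + 1 + (z - 1) * t)) ^ j)%C). ring.
- apply Csmooth_plus; [|apply Csmooth_plus]; apply Csmooth_scal.
  + apply Csmooth_pow, Csmooth_qpoly.
  + apply Csmooth_mult; [apply Csmooth_pow, Csmooth_upath|apply Csmooth_pow, Csmooth_qpoly].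
  + apply Csmooth_pow, Csmooth_qpoly.
- replace ((4 * K + 1) * (z - 1) ^ 2 * Q (S j) z - K * (2 * (1 + z ^ 2) * Q2 j z - 4 * z ^ 2 * Q j z))%C
    with ((4 * K + 1) * (z - 1) ^ 2 * Q (S j) z
      + ((- 2 * K * (1 + z ^ 2)) * Q2 j z + 4 * K * z ^ 2 * Q j z))%C by ring.
  apply is_CRInt_plus; [apply is_CRInt_Cmult, (Q_int (S j) z)|].
  apply is_CRInt_plus; apply is_CRInt_Cmult; [apply (Q2_int j z)|apply (Q_int j z)].
Qed.

(** The case (al, be) = (0, 1): multiply the previous expression of u W' by u^2 and eliminate u^4
    through u^4 = (1 + z^2) u^2 - z^2 - W. *)
Lemma Q2_rec (j : nat) (z : C) : let K := RtoC (INR (S j)) in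
  ((z - 1) ^ 2 * ((4 * K + 3) * Q2 (S j) z + 2 * K * (1 + z ^ 2) * Q (S j) z)
   = - K * ((4 * z ^ 2 - 2 * (1 + z ^ 2) ^ 2) * Q2 j z + 2 * (1 + z ^ 2) * z ^ 2 * Q j z))%C.
Proof.
intros K. apply Ceq_minus.
apply (qpoly_exact z j 0 1 _ (fun t =>
  (4 * K + 3) * (z - 1) ^ 2 * (upath z t ^ 2 * qpoly z t ^ S j)
  + (2 * K * (1 + z ^ 2) * (z - 1) ^ 2 * qpoly z t ^ S j
  + (K * (4 * z ^ 2 - 2 * (1 + z ^ 2) ^ 2) * (upath z t ^ 2 * qpoly z t ^ j)
     + 2 * K * (1 + z ^ 2) * z ^ 2 * qpoly z t ^ j)))%C).
- intros t. fold K. simpl Cpow. unfold dqpoly, upath, qpoly.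
  set (P := ((t * (1 - t) * (2 + (z - 1) * t) * (z + 1 + (z - 1) * t)) ^ j)%C). ring.
- assert (H1 : forall n, Csmooth (fun t => qpoly z t ^ n)%C)
    by (intros n; apply Csmooth_pow, Csmooth_qpoly).
  assert (H2 : forall n, Csmooth (fun t => upath z t ^ 2 * qpoly z t ^ n)%C)
    by (intros n; apply Csmooth_mult; [apply Csmooth_pow, Csmooth_upath|apply H1]).
  apply Csmooth_plus; [apply Csmooth_scal, H2|].
  apply Csmooth_plus; [apply Csmooth_scal, H1|].
  apply Csmooth_plus; apply Csmooth_scal; [apply H2|apply H1].
- match goal with |- is_RInt _ _ _ ?v => replace v with
   ((4 * K + 3) * (z - 1) ^ 2 * Q2 (S j) z
    + (2 * K * (1 + z ^ 2) * (z - 1) ^ 2 * Q (S j) z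
    + (K * (4 * z ^ 2 - 2 * (1 + z ^ 2) ^ 2) * Q2 j z
     + 2 * K * (1 + z ^ 2) * z ^ 2 * Q j z)))%C by ring end.
  apply is_CRInt_plus; [apply is_CRInt_Cmult, (Q2_int (S j) z)|].
  apply is_CRInt_plus; [apply is_CRInt_Cmult, (Q_int (S j) z)|].
  apply is_CRInt_plus; apply is_CRInt_Cmult; [apply (Q2_int j z)|apply (Q_int j z)].
Qed.

Lemma Q_0 z : Q 0 z = 1.
Proof.
apply (is_CRInt_unique _ 0 1 _ _ (Q_int 0 z)).
apply is_CRInt_RtoC.
apply is_RInt_ext with (2 := is_RInt_beta_nat 0).
intros x _. simpl. ring.
Qed.

Lemma Q2_0 z : Q2 0 z = ((z ^ 2 + z + 1) / 3)%C.
Proof.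
apply (is_CRInt_unique _ 0 1 _ _ (Q2_int 0 z)).
set (G := fun t : R => (t * (1 + (z - 1) * t + (z - 1) ^ 2 / 3 * (t * t)))%C).
replace ((z ^ 2 + z + 1) / 3)%C with (G 1 - G 0)%C by (unfold G; field).
assert (Hu : Csmooth (fun t => upath z t ^ 2 * qpoly z t ^ 0)%C)
  by (apply Csmooth_mult; apply Csmooth_pow; [apply Csmooth_upath|apply Csmooth_qpoly]).
apply is_CRInt_derive.
- intros t _.
  pose proof (is_Cderive_mult _ _ t _ _ (is_Cderive_id t)
    (is_Cderive_plus _ _ t _ _ (is_Cderive_upath z t)
      (is_Cderive_scal ((z - 1) ^ 2 / 3)%C _ t _ (is_Cderive_mult _ _ t _ _ (is_Cderive_id t) (is_Cderive_id t))))) as H.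
  match type of H with is_derive _ _ ?v =>
    replace (upath z t ^ 2 * qpoly z t ^ 0)%C with (v : C); [exact H|] end.
  unfold upath. simpl Cpow. field.
- intros t _. destruct (Hu t) as [l Hl]. exact (is_Cderive_continuous _ _ _ Hl).
Qed.

(** * The identity on the unit circle *)

(** K stands for m + 1, w for sqrt z, P for (z + 1)^(2m+1); put n = 2 kap w / P. In A1 the
    prescribed B cancels the terms in a^2 q and leaves 4 K (1 - a^2) A1 = n (4K - 1)(q - a q2 / z).
    The recurrence for q' has - 4 K z^2 (q - a q2 / z) on its right, and the value of 1 - a^2 in
    terms of z turns the quotient into kap' / kap divided by (z + 1)^2. *)
Lemma induction_step_algebra (K z w kap q q2 q' q2' a A B P : C) :
  K <> 0 -> (4 * K + 1 <> 0)%C -> (4 * K + 3 <> 0)%C ->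
  z <> 0 -> (z - 1 <> 0)%C -> (z + 1 <> 0)%C -> P <> 0 ->
  (2 * a * z = z ^ 2 + 1)%C ->
  ((4 * K + 1) * (z - 1) ^ 2 * q' = K * (2 * (1 + z ^ 2) * q2 - 4 * z ^ 2 * q))%C ->
  ((z - 1) ^ 2 * ((4 * K + 3) * q2' + 2 * K * (1 + z ^ 2) * q')
   = - K * ((4 * z ^ 2 - 2 * (1 + z ^ 2) ^ 2) * q2 + 2 * (1 + z ^ 2) * z ^ 2 * q))%C ->
  A = (kap * w * 2 / P * q)%C ->
  ((4 * K - 3) * B = - (kap * w * 2 / P) * ((4 * K - 2) * a * q - (4 * K - 1) * q2 / z))%C ->
  let B1 := (((4 * K - 3) * B - a * A) / (4 * K * (1 - a ^ 2)))%C in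
  let A1 := ((4 * K - 1) / (4 * K) * A - a * B1)%C in
  let kap' := ((4 * K + 1) * (4 * K - 1) / (4 * K ^ 2) * kap)%C in
  A1 = (kap' * w * 2 / ((z + 1) ^ 2 * P) * q')%C /\
  ((4 * K + 1) * B1
   = - (kap' * w * 2 / ((z + 1) ^ 2 * P)) * ((4 * K + 2) * a * q' - (4 * K + 3) * q2' / z))%C.
Proof.
intros HK HK1 HK3 Hz Hzm Hzp HP Ha Hq Hq2 HA HB B1 A1 kap'.
assert (Ea : a = ((z ^ 2 + 1) / (2 * z))%C) by (rewrite <- Ha; field; assumption).
assert (Hzm2 : ((z - 1) ^ 2 <> 0)%C) by now apply Cpow_nz.
assert (Eq : q' = (K * (2 * (1 + z ^ 2) * q2 - 4 * z ^ 2 * q) / ((4 * K + 1) * (z - 1) ^ 2))%C)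
  by (rewrite <- Hq; field; split; assumption).
assert (Eq2 : q2' = ((- K * ((4 * z ^ 2 - 2 * (1 + z ^ 2) ^ 2) * q2 + 2 * (1 + z ^ 2) * z ^ 2 * q) / (z - 1) ^ 2
  - 2 * K * (1 + z ^ 2) * q') / (4 * K + 3))%C)
  by (rewrite <- Hq2; field; split; assumption).
assert (Hd : ((2 * z) ^ 2 - (z ^ 2 + 1) ^ 2 <> 0)%C).
{ replace ((2 * z) ^ 2 - (z ^ 2 + 1) ^ 2)%C with (- ((z - 1) ^ 2 * (z + 1) ^ 2))%C by ring.
  intros E. apply (Cmult_neq_0 _ _ Hzm2 (Cpow_nz (z + 1)%C 2 Hzp)).
  transitivity (- - ((z - 1) ^ 2 * (z + 1) ^ 2))%C; [ring|]. rewrite E. ring. }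
assert (EB1 : B1 = ((- (kap * w * 2 / P) * ((4 * K - 2) * a * q - (4 * K - 1) * q2 / z) - a * A) / (4 * K * (1 - a ^ 2)))%C)
  by (unfold B1; now rewrite HB).
unfold A1. rewrite EB1. unfold kap'. rewrite Eq2, Eq, HA, Ea. clear - HK HK1 HK3 Hz Hzm Hzp HP Hd.
split; field; repeat split; try assumption.
Qed.

(** The constant B(1/2, 2m + 3/2) / (2 B(m+1, m+1)) of the theorem. In the ratio of consecutive
    values the factor 4K + 2 cancels between [tau] and [beta_nat]. *)
Definition kappa (m : nat) : R := tau m / beta_nat m.

Lemma kappa_S (j : nat) : let K := RtoC (INR (S j)) in
  RtoC (kappa (S j)) = ((4 * K + 1) * (4 * K - 1) / (4 * K ^ 2) * kappa j)%C.
Proof.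
intros K.
assert (HK : 0 < INR (S j)) by apply lt_0_INR, Nat.lt_0_succ.
pose proof (beta_nat_pos j) as Hb.
assert (E : kappa (S j) = (4 * INR (S j) + 1) * (4 * INR (S j) - 1) / (4 * INR (S j) ^ 2) * kappa j).
{ unfold kappa. cbn [tau beta_nat]. field. repeat split; lra. }
rewrite E. unfold K.
rewrite RtoC_mult, RtoC_div by nra. rewrite !RtoC_mult, RtoC_plus, RtoC_minus, RtoC_pow, !RtoC_mult.
reflexivity.
Qed.

Lemma cis_half (theta : R) : let w := cis (theta / 2) in let z := cis theta in
  z = (w * w)%C /\ (z + 1 = 2 * cos (theta / 2) * w)%C /\ (2 * cos theta * z = z ^ 2 + 1)%C.
Proof.
intros w z.
assert (Hc : cos theta = 2 * cos (theta / 2) * cos (theta / 2) - 1)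
  by (rewrite <- cos_2a_cos; f_equal; field).
assert (Hs : sin theta = 2 * sin (theta / 2) * cos (theta / 2))
  by (rewrite <- sin_2a; f_equal; field).
pose proof (sin2_cos2 (theta / 2)) as H2. pose proof (sin2_cos2 theta) as H3. unfold Rsqr in *.
unfold w, z, cis. split; [|split]; apply injective_projections; simpl; try rewrite Hc; try rewrite Hs; nra.
Qed.

(** The induction carries both integrals as real numbers A and B, and the complex identities they
    satisfy. Excluding theta = 0 gives s <> 0 for the base case and a^2 <> 1 for the recurrence. *)
Lemma N04_cis (m : nat) (theta : R) : - PI < theta < PI -> theta <> 0 ->
  let w := cis (theta / 2) in let z := cis theta in
  RtoC (N04 (cos theta) m) = (kappa m * w * 2 / (z + 1) ^ (2 * m + 1) * Q m z)%C.
Proof.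
intros Ht Ht0 w z.
set (c := cos (theta / 2)). set (s := sin (theta / 2)). set (a := cos theta).
assert (Hc : 0 < c) by (apply cos_gt_0; lra).
assert (Hs : s <> 0).
{ unfold s. destruct (Rtotal_order theta 0) as [H|[H|H]]; [|contradiction|].
  - apply Rlt_not_eq. apply sin_lt_0_var; lra.
  - apply Rgt_not_eq. apply sin_gt_0; lra. }
assert (Hcs : s * s = 1 - c * c)
  by (pose proof (sin2_cos2 (theta / 2)) as H; unfold Rsqr in H; fold c s in H; lra).
assert (Ha : a = 2 * c * c - 1) by (unfold a, c; rewrite <- cos_2a_cos; f_equal; field).
assert (Ha2 : a ^ 2 <> 1).
{ assert (E : 1 - a ^ 2 = 4 * (c * c) * (s * s)) by (rewrite Hcs, Ha; ring).
  assert (0 < 4 * (c * c) * (s * s)) by (apply Rmult_lt_0_compat; [nra|exact (Rlt_0_sqr s Hs)]).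
  lra. }
destruct (cis_half theta) as (Hzw & Hz1 & Hza). fold w z in Hzw, Hz1, Hza. fold c in Hz1. fold a in Hza.
assert (Hw : w <> 0).
{ intros E. apply (f_equal Re) in E. simpl in E. fold c in E. lra. }
assert (Hz : z <> 0) by (rewrite Hzw; now apply Cmult_neq_0).
assert (Hcc : RtoC c <> 0) by (intros E; apply RtoC_inj in E; lra).
assert (Hzp : (z + 1 <> 0)%C).
{ rewrite Hz1. repeat apply Cmult_neq_0; try assumption. intros E. apply RtoC_inj in E. lra. }
assert (Hzm : (z - 1 <> 0)%C).
{ intros E. apply Ceq_minus in E. rewrite E in Hza. apply Ha2.
  assert (E2 : RtoC a = 1).
  { replace (RtoC a) with ((2 * a * 1) / 2)%C by field. rewrite Hza. field. }
  apply RtoC_inj in E2. rewrite E2. ring. }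
assert (H : forall m, exists A B : R,
  improper_primitive (fun x => / (x ^ 4 + 2 * a * x ^ 2 + 1) ^ S m) A /\
  improper_primitive (fun x => x ^ 2 / (x ^ 4 + 2 * a * x ^ 2 + 1) ^ S m) B /\
  RtoC A = (kappa m * w * 2 / (z + 1) ^ (2 * m + 1) * Q m z)%C /\
  ((4 * INR (S m) - 3) * B = - (kappa m * w * 2 / (z + 1) ^ (2 * m + 1)) *
     ((4 * INR (S m) - 2) * a * Q m z - (4 * INR (S m) - 1) * Q2 m z / z))%C).
{ clear m. induction m as [|j (A & B & HA & HB & EA & EB)].
  (* Both integrals equal PI / (4 c). This fits because z + 1 = 2 c w, and because (z^2 + z + 1) / z
     = 2 a + 1 makes the bracket of the second relation equal to -1. *)
  - destruct (quartic_base c s a Hc Hcs Ha Hs) as [H1 H2].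
    exists (PI / (4 * c)), (PI / (4 * c)). split; [exact H1|]. split; [exact H2|].
    assert (Ek : kappa 0 = PI / 4) by (unfold kappa; simpl; field).
    assert (EPc : RtoC (PI / (4 * c)) = (PI / (4 * c))%C) by (rewrite RtoC_div, RtoC_mult by lra; reflexivity).
    assert (EP4 : RtoC (PI / 4) = (PI / 4)%C) by (rewrite RtoC_div by lra; reflexivity).
    change (INR (S 0)) with 1. change (2 * 0 + 1)%nat with 1%nat.
    rewrite Q_0, Q2_0, Ek, EPc, EP4. simpl Cpow.
    assert (Ea : RtoC a = ((z ^ 2 + 1) / (2 * z))%C) by (rewrite <- Hza; field; assumption).
    rewrite Ea, Cmult_1_r, Hz1. split; field; repeat split; try assumption.
  - pose proof (quartic_rec_x2 c s a Hc Hcs Ha j A B Ha2 HA HB) as HB1.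
    pose proof (quartic_rec_1 c s a Hc Hcs Ha j A _ HA HB1) as HA1.
    eexists. eexists. split; [exact HA1|]. split; [exact HB1|].
    set (K := INR (S j)) in *.
    assert (HK : 0 < K) by apply lt_0_INR, Nat.lt_0_succ.
    assert (Hnz : forall x, x <> 0 -> RtoC x <> 0) by (intros x Hx E; apply Hx, RtoC_inj, E).
    assert (EBC : RtoC (((4 * K - 3) * B - a * A) / (4 * K * (1 - a ^ 2)))
      = (((4 * K - 3) * B - a * A) / (4 * K * (1 - a ^ 2)))%C).
    { rewrite RtoC_div.
      - rewrite !RtoC_minus, !RtoC_mult, !RtoC_minus, !RtoC_mult, RtoC_pow. reflexivity.
      - apply Rmult_integral_contrapositive_currified; lra. }
    rewrite RtoC_minus, !(RtoC_mult _ A), !(RtoC_mult a), EBC, RtoC_div, RtoC_minus, !RtoC_mult by lra.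
    rewrite (S_INR (S j)). fold K.
    replace (4 * RtoC (K + 1) - 3)%C with (4 * K + 1)%C by (rewrite RtoC_plus; ring).
    replace (4 * RtoC (K + 1) - 2)%C with (4 * K + 2)%C by (rewrite RtoC_plus; ring).
    replace (4 * RtoC (K + 1) - 1)%C with (4 * K + 3)%C by (rewrite RtoC_plus; ring).
    replace ((z + 1) ^ (2 * S j + 1))%C with ((z + 1) ^ 2 * (z + 1) ^ (2 * j + 1))%C
      by (rewrite <- Cpow_add_r; f_equal; lia).
    rewrite kappa_S. fold K.
    apply (induction_step_algebra K z w (kappa j) (Q j z) (Q2 j z) (Q (S j) z) (Q2 (S j) z) a A B);
      try assumption.
    + apply Hnz. lra.
    + rewrite <- RtoC_mult, <- RtoC_plus. apply Hnz. lra.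
    + rewrite <- RtoC_mult, <- RtoC_plus. apply Hnz. lra.
    + now apply Cpow_nz.
    + apply Q_rec.
    + apply Q2_rec. }
destruct (H m) as (A & B & HA & _ & EA & _).
rewrite (N04_of_primitive c s a Hc Hcs Ha m A HA). exact EA.
Qed.

Lemma N04_1 (m : nat) : N04 1 m = tau m.
Proof.
apply (N04_of_primitive 1 0 1); try lra.
eapply improper_primitive_ext; [|apply improper_primitive_tau].
intros x. replace (2 * m + 2)%nat with (2 * S m)%nat by lia.
rewrite pow_mult. do 2 f_equal. ring.
Qed.

Lemma I_rat_1 (m : nat) : I_rat m 1 = beta_nat m.
Proof.
unfold I_rat.
assert (H4 : (4 ^ m <> 0)%C) by (apply Cpow_nz; intros E; apply RtoC_inj in E; lra).
assert (E : Q m 1 = (4 ^ m * beta_nat m)%C).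
{ apply (is_CRInt_unique _ 0 1 _ _ (Q_int m 1)).
  pose proof (is_CRInt_Cmult (4 ^ m)%C _ _ _ _ (is_CRInt_RtoC _ _ _ _ (is_RInt_beta_nat m))) as H.
  eapply (is_RInt_ext (V := C_R_NormedModule)); [|exact H].
  intros t _. replace (qpoly 1 t) with (4 * (t * (1 - t)))%C by (unfold qpoly; ring).
  rewrite RtoC_mult, !RtoC_pow, RtoC_minus, !Cpow_mult_l. reflexivity. }
rewrite E. replace (1 + 1)%C with (RtoC 2) by ring.
rewrite Cpow_add_r, Cpow_mult_r. replace (2 ^ 2)%C with (RtoC 4) by ring.
simpl Cpow. field. assumption.
Qed.

Theorem theorem2p2 (m : nat) (theta : R) (htheta : - PI < theta < PI)
  (z : C) (hz : z = cis theta) (a : R) (ha : a = cos theta) :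
  RtoC (N04 a m) =
    (RtoC (Beta (1 / 2) (2 * INR m + 3 / 2)
           / (2 * Beta (INR m + 1) (INR m + 1)))
     * Csqrt z * I_ m z)%C.
Proof.
subst z a.
rewrite Beta_half, (Beta_at_nat m _ (is_RInt_beta_nat m)), Csqrt_cis by assumption.
pose proof (beta_nat_pos m) as Hb.
replace (2 * tau m / (2 * beta_nat m)) with (kappa m) by (unfold kappa; field; lra).
assert (Hslit : slit_plane (cis theta)).
{ intros [Hi Hr]. simpl in Hi, Hr.
  assert (Hc : 0 < cos (theta / 2)) by (apply cos_gt_0; lra).
  assert (Hcc : cos theta = 2 * cos (theta / 2) * cos (theta / 2) - 1)
    by (rewrite <- cos_2a_cos; f_equal; field).
  pose proof (sin2_cos2 theta) as H1. unfold Rsqr in H1. rewrite Hi in H1.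
  assert (cos theta = -1) by nra. nra. }
rewrite I_eq_I_rat by assumption.
(* At theta = 0 the identity reduces to [tau m] = [kappa m] times [beta_nat m], which is the
   definition of [kappa]. *)
destruct (Req_dec theta 0) as [->|Ht0].
- replace (0 / 2) with 0 by field.
  assert (Ecis : cis 0 = 1) by (unfold cis; rewrite cos_0, sin_0; reflexivity).
  rewrite Ecis, I_rat_1, cos_0, N04_1, Cmult_1_r, <- RtoC_mult. f_equal. unfold kappa. field. lra.
- rewrite N04_cis by assumption. unfold I_rat, Cdiv. ring.
Qed.
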